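(* Let $q$ be a power of an odd prime, $d\ge4$ even, $j\in\mathbb F_q^*$, $S_j=\{x\in\mathbb F_q^d: x_1^2+\cdots+x_d^2=j\}$, $A\subset S_j$ and $B\subset\mathbb F_q^d$. If $|A||B|\ge16q^d$ and either $|A|\le q^{(d-1)/2}$ or $|A|\ge q^{d/2}$, then $|\Delta(A,B)|\ge q/144$.
   Context: $\|x-y\|=\sum_{i}(x_i-y_i)^2$ and $\Delta(A,B)=\{\|a-b\|:a\in A,b\in B\}$. *)

(* Defs.v *)
From HB Require Import structures.
From mathcomp Require Import all_boot all_order all_algebra.
Set Implicit Arguments. Unset Strict Implicit. Unset Printing Implicit Defensive.
Import Order.TTheory GRing.Theory Num.Theory.
Local Open Scope ring_scope.

Definition qdist (F : finFieldType) (d : nat) (x y : 'rV[F]_d) : F :=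
  \sum_(i < d) (x ord0 i - y ord0 i) ^+ 2.

Definition sphere (F : finFieldType) (d : nat) (j : F) : {set 'rV[F]_d} :=
  [set x : 'rV[F]_d | \sum_(i < d) (x ord0 i) ^+ 2 == j].

Definition dist_set (F : finFieldType) (d : nat) (A B : {set 'rV[F]_d}) : {set F} :=
  [set qdist a b | a in A, b in B].

(* Main.v *)
Require Import Defs.
From HB Require Import structures.
From mathcomp Require Import all_boot all_order all_algebra.
From mathcomp Require Import all_fingroup all_field all_character.
From mathcomp Require Import ring lra zify.
Set Implicit Arguments. Unset Strict Implicit. Unset Printing Implicit Defensive.
Import Order.TTheory GRing.Theory Num.Theory.
Local Open Scope ring_scope.

(** Write [n t] for the number of pairs in [A * B] at distance [t], [X] for
    [#|A| * #|B|] and [psi] for a nontrivial additive character; by Cauchy-Schwarz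
    it is enough to bound the energy [sum_t (n t)^2] by a multiple of [X^2 / q].

    If [A] is large, write the energy with additive characters and apply
    Cauchy-Schwarz in [a], enlarging [A] to the whole sphere: after completing
    squares the correlation of two points [b], [b'] counts the roots of a quadratic
    polynomial, hence is [O(q^(d/2))].

    If [A] is small, drop the distance [0] (it accounts for at most half of the
    pairs) and apply Cauchy-Schwarz in [b], enlarging [B] to the whole space.  The
    functions [b |-> psi (s * |a - b|)] have Gram matrix
    [g * psi (- s s' / (s - s') * |a - a'|)], a Toeplitz matrix in the coordinate
    [1 / s], so its eigenvalues are Kloosterman sums, and Weil's bound
    [2 * sqrt q] for them gives the energy bound as [#|A|^2 <= q^(d-1)].

    Weil's bound is obtained from the Kloosterman sums [K_n] over the extensions of
    degree [n].  Summing a multiplicative function over monic polynomials (the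
    L-function) gives [K_n = - (alpha^n + beta^n)] with [alpha * beta = q].  By
    additive Hilbert 90 the sum of the [K_n] over all nontrivial characters counts
    points of [w^2 = (y^q - y)^2 - 4 a b]; Stepanov's method in Bombieri's form
    (an auxiliary polynomial whose [l]-th power vanishes at the rational points,
    where [l^2 = q^n]) bounds it by [O(q^(n/2))], so every [alpha] and [beta] has
    absolute value at most [sqrt q]. *)

(** * Frobenius powers and Stepanov's method *)

(** [#|F|] elaborates to several convertible but syntactically different terms,
    which [lia] cannot identify; [fsize F] gives it a single form. *)
Definition fsize (F : finFieldType) : nat := #|F|.

Lemma fsize_gt1 (F : finFieldType) : (1 < fsize F)%N.
Proof. exact: finNzRing_gt1. Qed.

Section Frobenius.
Variables (F : finFieldType) (K : comNzRingType) (iota : {rmorphism F -> K}).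
Local Notation q := (fsize F).

Lemma pnat_card_pchar m : [pchar K].-nat (q ^ m)%N.
Proof.
have [p pr_p pF] := finPcharP F.
have pK : p \in [pchar K] by rewrite (fmorph_pchar iota).
rewrite (eq_pnat _ (pcharf_eq pK)) /fsize (card_pprimeChar pF).
by rewrite pnatX pnatX pnat_id.
Qed.

Lemma frobD m (x y : K) : (x + y) ^+ (q ^ m) = x ^+ (q ^ m) + y ^+ (q ^ m).
Proof. exact/exprDn_pchar/pnat_card_pchar. Qed.

Lemma card_fin_gt0 m : (0 < q ^ m)%N.
Proof. by rewrite expn_gt0 (ltnW (fsize_gt1 F)). Qed.

Lemma frob0 m : (0 : K) ^+ (q ^ m) = 0.
Proof. by rewrite expr0n gtn_eqF // card_fin_gt0. Qed.

Lemma frob_sum m I (r : seq I) (P : pred I) (G : I -> K) :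
  (\sum_(i <- r | P i) G i) ^+ (q ^ m) = \sum_(i <- r | P i) G i ^+ (q ^ m).
Proof. exact: (big_morph (fun x => x ^+ (q ^ m)) (frobD m) (frob0 m)). Qed.

Lemma frobN m (x : K) : (- x) ^+ (q ^ m) = - x ^+ (q ^ m).
Proof.
by apply/eqP; rewrite -subr_eq0 opprK -frobD addNr frob0.
Qed.

Lemma frobB m (x y : K) : (x - y) ^+ (q ^ m) = x ^+ (q ^ m) - y ^+ (q ^ m).
Proof. by rewrite frobD frobN. Qed.

Lemma expf_card_expn m (x : F) : x ^+ (q ^ m) = x.
Proof. by elim: m => // m IH; rewrite expnS exprM [x ^+ _]expf_card. Qed.

Lemma frob_iota m (x : F) : iota x ^+ (q ^ m) = iota x.
Proof. by rewrite -rmorphXn expf_card_expn. Qed.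

End Frobenius.

Lemma poly_frob (F : finFieldType) m (p : {poly F}) :
  p ^+ (fsize F ^ m) = p \Po 'X^(fsize F ^ m).
Proof.
rewrite -{1}[p]coefK poly_def (frob_sum polyC) comp_polyE.
apply: eq_bigr => i _.
by rewrite exprZn expf_card_expn -!exprM mulnC.
Qed.

Section BivariateSize.
Variable (R : idomainType).

(** Kronecker substitution: the coefficients have degree below [l], so after putting ['X^l] for the
    outer variable they occupy disjoint ranges of exponents and cannot cancel. *)
Lemma horner_Xn_eq0 l (P : {poly {poly R}}) :
  (forall i, size (P`_i)%R <= l)%N -> P.['X^l] = 0 -> P = 0.
Proof.
elim/poly_ind: P => [//|P c IH] hs.
rewrite hornerD hornerM hornerX hornerC => h.
have c0 : c = 0.
  have sc : (size c <= l)%N by have := hs 0%N; rewrite coefD coefMX coefC add0r.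
  apply/polyP => i; rewrite coef0.
  have [il|il] := leqP l i; first by rewrite nth_default // (leq_trans sc).
  by move/(congr1 (fun p : {poly R} => p`_i)): h; rewrite coefD coefMXn il add0r coef0.
rewrite c0 addr0 (IH _ _) ?mul0r //.
  by move=> i; have := hs i.+1; rewrite coefD coefMX coefC addr0.
move/eqP: h; rewrite c0 addr0 mulf_eq0 => /orP[/eqP //|].
by rewrite expf_eq0 polyX_eq0 andbF.
Qed.

Lemma size_coef_mul a b (P Q : {poly {poly R}}) :
    (forall i, size (P`_i)%R <= a.+1)%N -> (forall i, size (Q`_i)%R <= b.+1)%N ->
  forall i, (size ((P * Q)`_i)%R <= (a + b).+1)%N.
Proof.
move=> hP hQ i; rewrite coefM (leq_trans (size_sum _ _ _)) //.
apply/bigmax_leqP => k _; rewrite (leq_trans (size_polyMleq _ _)) //.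
by move: (hP k) (hQ (i - k)%N); lia.
Qed.

End BivariateSize.

Section Stepanov.
Variables (F : finFieldType) (C : closedFieldType) (iota : {rmorphism F -> C}).
Hypothesis oddF : odd (fsize F).
Variables (c : F) (c_neq0 : c != 0).
Local Notation q := (fsize F).

(** For [c = 4 * a * b] this is the discriminant of
    [a * x ^ 2 - (y ^ q - y) * x + b] as a polynomial in [y]. *)
Definition stepD : {poly F} := ('X^q - 'X) ^+ 2 - c%:P.
Local Notation D := stepD.
Local Notation "p ^i" := (map_poly iota p) (at level 2, format "p ^i") : ring_scope.

Lemma natF_eq0 : (q%:R : F) = 0.
Proof.
have q1 := fsize_gt1 F.
have /pnatP := @pnat_card_pchar F F idfun 1; rewrite expn1 => /(_ (ltnW q1)).
move=> /(_ _ (pdiv_prime q1) (pdiv_dvd _)) h.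
by apply/eqP; rewrite -(dvdn_pcharf h) pdiv_dvd.
Qed.

Lemma two_neq0 : (2 : F) != 0.
Proof.
apply/eqP => h; have := natF_eq0; rewrite -(odd_double_half q) oddF.
by rewrite natrD -muln2 natrM h mulr0 addr0 => /eqP; rewrite oner_eq0.
Qed.

Lemma size_stepD : size D = (2 * q).+1.
Proof.
have q1 := fsize_gt1 F.
have s1 : size ('X^q - 'X : {poly F}) = q.+1.
  by rewrite size_polyDl size_polyXn // size_polyN size_polyX; lia.
have s2 : size (('X^q - 'X : {poly F}) ^+ 2) = (2 * q).+1.
  have := size_exp ('X^q - 'X : {poly F}) 2; rewrite s1 /=.
  by case: (size _) => [|n] /=; lia.
by rewrite /D size_polyDl s2 // size_polyN size_polyC c_neq0; lia.
Qed.

Lemma stepD_neq0 : D != 0.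
Proof. by rewrite -size_poly_eq0 size_stepD. Qed.

Lemma map_stepD : D^i = ('X^q - 'X) ^+ 2 - (iota c)%:P.
Proof. by rewrite rmorphB rmorphXn rmorphB /= map_polyXn map_polyX map_polyC. Qed.

(** As [q] is zero in [F], the derivative of [D] is [- 2 * (y ^ q - y)]. A multiple root would
    satisfy [y ^ q = y], but there [D] takes the value [- c], which is nonzero; so any root will
    do. *)
Lemma mup_stepD : exists z, mup z D^i = 1%N.
Proof.
have /closed_rootP[z rz] : size D^i != 1.
  by rewrite size_map_poly size_stepD; have := fsize_gt1 F; lia.
exists z.
have D0 : D^i != 0 by rewrite map_poly_eq0 stepD_neq0.
apply/eqP; rewrite eqn_leq mup_geq // expr1 dvdp_XsubCl rz andbT mup_leq //.
apply/negP => /dvdpP[E hE].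
have : root (D^i)^`() z.
  rewrite hE derivM deriv_exp /root !hornerE subrr expr0n /=.
  by rewrite !(mulr0, mul0rn, mul0r, mulr0, addr0).
rewrite map_stepD derivB derivC subr0 deriv_exp derivB derivXn derivX.
have q0 : (q%:R : C) = 0 by rewrite -(rmorph_nat iota) natF_eq0 rmorph0.
rewrite -[X in X - 1]mulr_natr -polyC_natr q0 mulr0 sub0r /root !hornerE /=.
rewrite expr1 -mulrDr mulN1r oppr_eq0 -mulr2n -mulr_natr -(rmorph_nat iota).
rewrite mulf_eq0 fmorph_eq0 (negbTE two_neq0) orbF /= => /eqP hz.
move: rz; rewrite map_stepD /root !hornerE /= hz expr0n sub0r /=.
by rewrite oppr_eq0 fmorph_eq0 (negbTE c_neq0).
Qed.

Section AuxiliaryPolynomial.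
Variables (m h A B : nat).
Local Notation l := (q ^ m)%N.
Hypothesis lh : l = (2 * h).+1.

(** [U] is the coefficient matrix of a bivariate polynomial; [loP U] is its value
    at [(y, y ^ l)], [hiP U] its value at [(y ^ l, y)], and [biP U] sees it as a
    polynomial in the second variable. *)
Definition loP (U : 'M[F]_(A, B)) : {poly F} :=
  \sum_k \sum_i U i k *: 'X^(i + l * k).
Definition hiP (U : 'M[F]_(A, B)) : {poly F} :=
  \sum_k \sum_i U i k *: 'X^(l * i + k).
Definition biP (U : 'M[F]_(A, B)) : {poly {poly F}} :=
  \poly_(k < B) \sum_i (if insub k is Some k' then U i k' else 0) *: 'X^i.

Lemma biP_horner U : (biP U).['X^l] = loP U.
Proof.
rewrite /biP horner_poly; apply: eq_bigr => k _.
rewrite mulr_suml; apply: eq_bigr => i _.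
by rewrite valK -scalerAl exprD -!exprM.
Qed.

Lemma size_coef_biP U k : (size ((biP U)`_k)%R <= A)%N.
Proof.
rewrite coef_poly; case: ifP => _; last by rewrite size_poly0.
rewrite (leq_trans (size_sum _ _ _)) //; apply/bigmax_leqP => i _.
by rewrite (leq_trans (size_scale_leq _ _)) // size_polyXn.
Qed.

Lemma biP_eq0 U : biP U = 0 -> U = 0.
Proof.
move=> h0; apply/matrixP => i k; rewrite mxE.
have := congr1 (fun p : {poly {poly F}} => p`_k`_i) h0.
rewrite coef_poly ltn_ord valK !coef0 coef_sum (bigD1 i) //= big1.
  by rewrite coefZ coefXn eqxx mulr1 addr0.
by move=> j ji; rewrite coefZ coefXn eq_sym val_eqE (negbTE ji) mulr0.
Qed.

(** Squaring the relation and comparing both sides as polynomials in two variables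
    gives [D(y) * U ^ 2 = D(z) * W ^ 2], where a simple root of [D(z)] contradicts
    the parity of multiplicities. *)
Lemma loP_inj (U W : 'M[F]_(A, B)) : (0 < A)%N -> (2 * A + 2 * q <= l.+1)%N ->
  loP U + D ^+ h * loP W = 0 -> U = 0 /\ W = 0.
Proof.
move=> A0 hA hUW; set DX := map_poly polyC D.
(* [D] has coefficients in [F], so substituting ['X^l] into it is the same as raising it to the
   power [l]. *)
have DXe : DX.['X^l] = D ^+ l.
  by rewrite [RHS]poly_frob /DX.
have sU V i : (size ((biP V)`_i)%R <= A.-1.+1)%N.
  by rewrite prednK // size_coef_biP.
have G0 : D%:P * biP U ^+ 2 - DX * biP W ^+ 2 = 0.
  apply: (@horner_Xn_eq0 _ l) => [i|].
    rewrite coefB (leq_trans (size_polyD _ _)) // size_polyN geq_max.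
    have s2 V : forall i, (size ((biP V ^+ 2)`_i)%R <= (A.-1 + A.-1).+1)%N.
      by move=> k; rewrite expr2; apply: size_coef_mul.
    apply/andP; split.
      rewrite (leq_trans (@size_coef_mul _ (2 * q) _ _ _ _ (s2 U) i)); [lia| |lia].
      by move=> k; rewrite coefC; case: ifP; rewrite ?size_poly0 // size_stepD.
    rewrite (leq_trans (@size_coef_mul _ 0 _ _ _ _ (s2 W) i)); [lia| |lia].
    by move=> k; rewrite coef_map size_polyC leq_b1.
  rewrite hornerD hornerN !expr2 !hornerM DXe hornerC !biP_horner.
  have -> : loP U = - (D ^+ h * loP W) by apply/eqP; rewrite -addr_eq0 hUW.
  by rewrite lh exprS mul2n -addnn exprD; ring.
have DX0 : DX != 0.
  by rewrite map_polyC_eq0 stepD_neq0.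
have [U0|U0] := eqVneq (biP U) 0.
  split; first exact: biP_eq0.
  apply: biP_eq0; move/eqP: G0; rewrite U0 expr0n mulr0 sub0r oppr_eq0.
  by rewrite mulf_eq0 (negbTE DX0) expf_eq0 => /eqP.
have [k Uk] : exists k, (biP U)`_k != 0.
  by exists (size (biP U)).-1; rewrite -lead_coefE lead_coef_eq0.
(* The inner variable is specialised at a point that keeps [D] and one coefficient of [biP U]
   nonzero; the value of [D] there is then a constant and contributes no multiplicity. *)
have /closed_nonrootP[y] : (D * (biP U)`_k)^i != 0.
  by rewrite map_poly_eq0 mulf_neq0 // stepD_neq0.
rewrite rmorphM rootM negb_or => /andP[yD yU].
pose ev := horner_eval y \o map_poly iota.
move/(congr1 (map_poly ev))/eqP: G0.
rewrite !expr2 rmorph0 rmorphB !rmorphM /= map_polyC /=.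
set U1 := map_poly _ (biP U); set W1 := map_poly _ (biP W).
have -> : map_poly ev DX = D^i.
  by apply/polyP => i; rewrite !coef_map /ev /= /horner_eval map_polyC hornerC.
have U10 : U1 != 0.
  apply: contraNneq yU => /(congr1 (fun p : {poly C} => p`_k)).
  by rewrite coef_map coef0 /= /horner_eval /root => ->.
rewrite subr_eq0 => /eqP UW.
have W10 : W1 != 0.
  apply: contraNneq U10 => W10; move/eqP: UW.
  by rewrite W10 !mulr0 !mulf_eq0 polyC_eq0 [_ == 0](negbTE yD) orbb.
have [z hz] := mup_stepD.
move/(congr1 (mup z)): UW.
have D0 : D^i != 0 by rewrite map_poly_eq0 stepD_neq0.
rewrite mupMr; last by rewrite rootC.
by rewrite !mupM ?mulf_neq0 // hz; lia.
Qed.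

Lemma hiPB U V : hiP (U - V) = hiP U - hiP V.
Proof.
rewrite /hiP -sumrB; apply: eq_bigr => k _; rewrite -sumrB.
by apply: eq_bigr => i _; rewrite !mxE scalerBl.
Qed.

Lemma size_loP U : (size (loP U) <= A + l * B.-1)%N.
Proof.
rewrite (leq_trans (size_sum _ _ _)) //; apply/bigmax_leqP => k _.
rewrite (leq_trans (size_sum _ _ _)) //; apply/bigmax_leqP => i _.
rewrite (leq_trans (size_scale_leq _ _)) // size_polyXn.
have : (l * k <= l * B.-1)%N by rewrite leq_mul2l; have := ltn_ord k; lia.
by have := ltn_ord i; lia.
Qed.

Lemma size_hiP U : (size (hiP U) <= l * A.-1 + B)%N.
Proof.
rewrite (leq_trans (size_sum _ _ _)) //; apply/bigmax_leqP => k _.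
rewrite (leq_trans (size_sum _ _ _)) //; apply/bigmax_leqP => i _.
rewrite (leq_trans (size_scale_leq _ _)) // size_polyXn.
have : (l * i <= l * A.-1)%N by rewrite leq_mul2l; have := ltn_ord i; lia.
by have := ltn_ord k; lia.
Qed.

Lemma size_stepDX n : (size (D ^+ n)%R <= (2 * q * n).+1)%N.
Proof. by rewrite (leq_trans (size_poly_exp_leq _ _)) // size_stepD. Qed.

Lemma size_mulDX n (p : {poly F}) s :
  (size p <= s)%N -> (size (D ^+ n * p)%R <= s + 2 * q * n)%N.
Proof.
move=> hp; rewrite (leq_trans (size_polyMleq _ _)) //.
by have := size_stepDX n; lia.
Qed.

(** Pigeonhole: there are [q ^ (2 * A * B)] pairs of matrices but at most [q ^ M] polynomials of
    size at most [M]. The combination is linear in the pair, so the difference of two colliding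
    pairs is sent to zero. *)
Lemma stepanov_exists (e : F) : (l * A.-1 + B + 2 * q * h < 2 * (A * B))%N ->
  exists U W : 'M[F]_(A, B),
    [/\ (U, W) != (0, 0) & e *: hiP W + D ^+ h * hiP U = 0].
Proof.
set M := (_ + _ + _)%N => hM.
pose g (p : 'M[F]_(A, B) * 'M[F]_(A, B)) := e *: hiP p.2 + D ^+ h * hiP p.1.
have sg p : (size (g p) <= M)%N.
  rewrite (leq_trans (size_polyD _ _)) // geq_max; apply/andP; split.
    by rewrite (leq_trans (size_scale_leq _ _)) // (leq_trans (size_hiP _)) // leq_addr.
  by rewrite size_mulDX // size_hiP.
have /injectivePn[x [y xy hxy]] :
    ~~ injectiveb (fun p => poly_rV (g p) : 'rV[F]_M).
  apply/negP => /injectiveP /leq_card.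
  rewrite card_prod !card_mx -expnD leq_exp2l ?finNzRing_gt1 //.
  by rewrite mul1n leqNgt addnn -mul2n hM.
have {}hxy : g x = g y by rewrite -(poly_rV_K (sg x)) hxy poly_rV_K.
exists (x.1 - y.1), (x.2 - y.2); split.
  apply: contraNneq xy => -[/eqP e1 /eqP e2].
  by move: e1 e2; rewrite !subr_eq0; case: x y {hxy} => ? ? [? ?] /= /eqP-> /eqP->.
move/eqP: hxy; rewrite -subr_eq0 => /eqP <-.
by rewrite /g !hiPB scalerBr mulrBr; ring.
Qed.

(** The [l]-th power fixes the coefficients, sends [y] to [y ^ l] and [y ^ l] back to [y]: the two
    arguments change places. *)
Lemma loP_frob U (y : C) : y ^+ (l * l) = y ->
  (loP U)^i.[y] ^+ l = (hiP U)^i.[y].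
Proof.
move=> hy; rewrite /loP /hiP !rmorph_sum !horner_sum (frob_sum iota).
apply: eq_bigr => k _; rewrite !rmorph_sum !horner_sum (frob_sum iota).
apply: eq_bigr => i _; rewrite /= !map_polyZ /= !map_polyXn !hornerE.
rewrite exprMn (frob_iota iota) -exprM.
have -> : ((i + l * k) * l = l * i + l * l * k)%N by ring.
by rewrite !exprD (exprM y (l * l)) hy.
Qed.

(** At the points considered, the [l]-th power of [loP U + D ^ h * loP W] is, up to
    a nonzero factor, the combination that [stepanov_exists] makes vanish. *)
Lemma stepanov_aux (e : F) (s : seq C) : e != 0 -> (0 < A)%N ->
    (2 * A + 2 * q <= l.+1)%N -> (l * A.-1 + B + 2 * q * h < 2 * (A * B))%N ->
    uniq s -> (forall y, y \in s ->
      y ^+ (l * l) = y /\ D^i.[y] ^+ (h * l.+1) = iota e) ->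
  (size s < A + l * B.-1 + 2 * q * h)%N.
Proof.
move=> e0 A0 hA hM us hs.
have [U [W [UW0 UW]]] := stepanov_exists e hM.
pose R := loP U + D ^+ h * loP W.
have R0 : R != 0.
  by apply: contraNneq UW0 => /(loP_inj A0 hA)[-> ->].
have sR : (size R <= A + l * B.-1 + 2 * q * h)%N.
  rewrite (leq_trans (size_polyD _ _)) // geq_max size_mulDX ?size_loP // andbT.
  by rewrite (leq_trans (size_loP _)) // leq_addr.
apply: leq_trans sR; rewrite -(size_map_poly iota).
apply: max_poly_roots => //; first by rewrite map_poly_eq0.
apply/allP => y /hs[hy hD]; rewrite /root.
have H0 : (D ^+ h)^i.[y] != 0.
  apply/eqP => hH; move/eqP: hD.
  rewrite exprM -horner_exp -rmorphXn /= hH exprS mul0r eq_sym fmorph_eq0.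
  by rewrite (negbTE e0).
suff : (D ^+ h)^i.[y] * R^i.[y] ^+ l == 0.
  by rewrite mulf_eq0 (negbTE H0) expf_eq0 => /andP[].
rewrite rmorphD rmorphM /= hornerD hornerM (frobD iota) exprMn !loP_frob //.
rewrite mulrDr mulrA -exprS.
have -> : (D ^+ h)^i.[y] ^+ l.+1 = iota e.
  by rewrite rmorphXn horner_exp -exprM hD.
apply/eqP; move/(congr1 (fun p => p^i.[y])): UW.
rewrite rmorphD rmorphM /= map_polyZ /= hornerD hornerM hornerZ rmorph0 horner0 => <-.
exact: addrC.
Qed.
End AuxiliaryPolynomial.

Lemma stepanov m (e : F) (s : seq C) : (2 < m)%N -> e != 0 -> uniq s ->
    (forall y, y \in s -> y ^+ (q ^ m * q ^ m) = y /\
      D^i.[y] ^+ ((q ^ m)./2 * (q ^ m).+1) = iota e) ->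
  (2 * size s <= q ^ m * q ^ m + (4 * q + 6) * q ^ m)%N.
Proof.
move=> m2 e0 us hs; set l := (q ^ m)%N; set h := l./2.
have q1 := fsize_gt1 F.
have lq : (q * q * 3 <= l)%N.
  have n0 : (0 < q ^ (m - 3))%N by rewrite expn_gt0 ltnW.
  have q2 : (2 < q)%N by case: q oddF q1 => [|[|[|]]].
  rewrite /l -(subnK m2) expnD (_ : (q ^ 3 = q * q * q)%N); last by ring.
  by rewrite mulnCA leq_mul // (leq_trans q2) // leq_pmull.
have lh : l = (2 * h).+1.
  by rewrite -(odd_double_half l) /l oddX oddF orbT /= add1n mul2n.
(* The first size is the largest one allowed by [2 * A + 2 * q <= l + 1]. The second makes the
   number of unknowns exceed the number of coefficients, which holds because [l] is at least
   [3 * q ^ 2]. *)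
have := @stepanov_aux m h (h.+1 - q)%N (h + q + 2)%N lh e s e0.
rewrite -/l => /(_ _ _ _ us) H.
have q3 : (3 * q <= q * q)%N.
  by rewrite leq_mul2r; case: q oddF q1 => [|[|[|]]].
have {hs H} : [/\ (0 < h.+1 - q)%N, (2 * (h.+1 - q) + 2 * q <= l.+1)%N &
    (l * (h.+1 - q).-1 + (h + q + 2) + 2 * q * h <
      2 * ((h.+1 - q) * (h + q + 2)))%N] ->
  (size s < h.+1 - q + l * (h + q + 2).-1 + 2 * q * h)%N.
  by case=> ? ? ?; apply: H.
move: (size s) (l) (h) lh lq => S {}l {}h lh lq H.
have [r hr] : exists r, h = (q + r)%N by exists (h - q)%N; lia.
have {}H : (S < h.+1 - q + l * (h + q + 2).-1 + 2 * q * h)%N.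
  apply: H; split; [lia|lia|].
  have -> : (h.+1 - q).-1 = r by lia.
  have -> : (h.+1 - q)%N = r.+1 by lia.
  move: (q) q3 lq hr => x q3 lq hr.
  by move: lq; rewrite lh hr; nia.
have e1 : (l * (h + q + 2).-1 = l * h + l * q + l)%N.
  by rewrite addn2 /=; ring.
move: (q) q3 lq hr H e1 => x q3 lq hr H e1.
have : (l * l = l * (2 * h) + l)%N by rewrite {2}lh; ring.
have : (2 * x * h <= x * l)%N by rewrite lh; nia.
have : (h <= l)%N by lia.
rewrite e1 in H; nia.
Qed.
End Stepanov.

(** * The L-function of a Kloosterman sum *)

Section LogPoly.
Variable K : fieldType.
Implicit Types f g : {poly K}.

(** For a monic [f] with roots [z] (none of them zero) this is
    [- sum (a * z + b / z)]. *)
Definition logp (a b : K) f : K := a * (f * 'X)`_(size f).-1 + b * (f`_1 / f`_0).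

Lemma size_monicB f m : f \is monic -> size f = m.+1 -> (size (f - 'X^m)%R <= m)%N.
Proof.
move=> mf sf; apply/leq_sizeP => i; rewrite leq_eqVlt => /orP[/eqP<-|im].
  move/monicP: mf; rewrite lead_coefE sf /= => mf.
  by rewrite coefB coefXn eqxx mf subrr.
by rewrite coefB coefXn nth_default ?sf // gtn_eqF // subrr.
Qed.

(** The coefficient below the leading one is additive on monic polynomials. The factor ['X] shifts
    it to index [m], so that it reads as zero in degree [0]. *)
Lemma subleadM f g m n : f \is monic -> g \is monic ->
    size f = m.+1 -> size g = n.+1 ->
  (f * g * 'X)`_(m + n) = (f * 'X)`_m + (g * 'X)`_n.
Proof.
move=> mf mg sf sg.
pose u : {poly K} := f - 'X^m; pose v : {poly K} := g - 'X^n.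
have su : (size u <= m)%N by exact: size_monicB.
have sv : (size v <= n)%N by exact: size_monicB.
have subX (p : {poly K}) k : ((p + 'X^k) * 'X)`_k = (p * 'X)`_k.
  by rewrite mulrDl -exprSr coefD coefXn ltn_eqF // addr0.
rewrite -[f](subrK 'X^m) -[g](subrK 'X^n) !subX -/u -/v.
have -> : (u + 'X^m) * (v + 'X^n) * 'X =
  u * v * 'X + 'X^m * (v * 'X) + 'X^n * (u * 'X) + 'X^((m + n).+1) :> {poly K}.
  by rewrite exprS exprD; ring.
rewrite !coefD !coefXnM !coefXn !ltnNge leq_addr leq_addl /= addKn addnK.
suff uv0 : (u * v * 'X)`_(m + n) = 0.
  by rewrite ltn_eqF // addr0 uv0 add0r addrC.
apply: nth_default.
clearbody u v; case: m n su sv {sf sg} => [|m] [|n] su sv.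
- by move: su; rewrite size_poly_leq0 => /eqP->; rewrite !mul0r size_poly0.
- by move: su; rewrite size_poly_leq0 => /eqP->; rewrite !mul0r size_poly0.
- by move: sv; rewrite size_poly_leq0 => /eqP->; rewrite mulr0 mul0r size_poly0.
rewrite (leq_trans (size_polyMleq _ _)) // size_polyX addn2 /=.
by apply: leq_ltn_trans (size_polyMleq _ _) _; move: (leq_add su sv); case: (_ + _)%N => //= k; lia.
Qed.

Lemma logpM a b f g : f \is monic -> g \is monic ->
  f`_0 != 0 -> g`_0 != 0 -> logp a b (f * g) = logp a b f + logp a b g.
Proof.
move=> mf mg f0 g0; rewrite /logp.
have nf := monic_neq0 mf; have ng := monic_neq0 mg.
have [m sf'] : exists m, size f = m.+1.
  by exists (size f).-1; rewrite prednK // size_poly_gt0.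
have [n sg'] : exists n, size g = n.+1.
  by exists (size g).-1; rewrite prednK // size_poly_gt0.
rewrite size_monicM // sf' sg' addnS /= (subleadM mf mg sf' sg').
rewrite !coefM !big_ord_recl !big_ord0 /= !subn0 subnn.
by field; rewrite f0 g0.
Qed.

Lemma logp1 a b : logp a b 1 = 0.
Proof. by rewrite /logp mul1r size_poly1 /= coefX coef1 mul0r !mulr0 addr0. Qed.

Lemma logp_prod a b (s : seq K) : 0 \notin s ->
  logp a b (\prod_(z <- s) ('X - z%:P)) = - \sum_(z <- s) (a * z + b / z).
Proof.
elim: s => [|z s IH]; first by rewrite !big_nil logp1 oppr0.
rewrite inE negb_or eq_sym => /andP[z0 s0]; rewrite !big_cons logpM ?monicXsubC //.
- rewrite IH // opprD; congr (_ + _); rewrite /logp size_XsubC /= mulrBl !coefE /=.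
  by rewrite mulr1 subr0 !sub0r invrN mul1r !mulrN opprD.
- exact: monic_prod_XsubC.
- by rewrite !coefE sub0r oppr_eq0.
rewrite -horner_coef0 horner_prod prodf_seq_neq0; apply/allP => y ys /=.
by rewrite !hornerE oppr_eq0; apply: contraNneq s0 => <-.
Qed.
End LogPoly.

(** * Finite extensions and Frobenius orbits inside an algebraically closed field *)

Section FixedField.
Variables (F : finFieldType) (C : closedFieldType) (iota : {rmorphism F -> C}).
Local Notation q := (fsize F).
Local Notation "p ^i" := (map_poly iota p) (at level 2, format "p ^i") : ring_scope.

Definition frobq (x : C) : C := x ^+ q.

Fact frobq_zmod : zmod_morphism frobq.
Proof. by move=> x y; rewrite /frobq -[q]expn1 (frobB iota). Qed.
Fact frobq_monoid : monoid_morphism frobq.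
Proof. by split=> [|x y]; rewrite /frobq ?expr1n ?exprMn. Qed.
HB.instance Definition _ := GRing.isZmodMorphism.Build C C frobq frobq_zmod.
HB.instance Definition _ := GRing.isMonoidMorphism.Build C C frobq frobq_monoid.

(** A total left inverse of [iota], so that it can be mapped over coefficients; outside the image it
    takes the default value [0]. *)
Definition emb_inv (x : C) : F := odflt 0 [pick t | iota t == x].

Lemma iotaK : cancel iota emb_inv.
Proof.
move=> t; rewrite /emb_inv; case: pickP => [u /eqP /fmorph_inj //|].
by move/(_ t); rewrite eqxx.
Qed.

(** ['X^q - 'X] is the product of the factors ['X - t] over [t] in [F], so a fixed point of
    Frobenius comes from [F]. *)
Lemma emb_invK x : x ^+ q = x -> iota (emb_inv x) = x.
Proof.
move=> hx; suff [t <-] : exists t, iota t = x by rewrite iotaK.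
have := congr1 (map_poly iota) (finField_genPoly F).
rewrite rmorphB /= map_polyXn map_polyX rmorph_prod /=.
move/(congr1 (fun p : {poly C} => p.[x])); rewrite !hornerE hx subrr.
rewrite horner_prod => /esym/eqP/prodf_eq0[t _].
rewrite rmorphB /= map_polyX map_polyC !hornerE subr_eq0 => /eqP e.
by exists t.
Qed.

Lemma poly_emb_invK (f : {poly C}) : map_poly frobq f = f -> (map_poly emb_inv f)^i = f.
Proof.
move=> hf; apply/polyP => i; rewrite coef_map /= coef_map_id0 ?emb_invK //.
  by rewrite -{2}hf coef_map.
by rewrite -(rmorph0 iota) iotaK.
Qed.

Lemma frobq_iota (f : {poly F}) : map_poly frobq f^i = f^i.
Proof.
by apply/polyP => i; rewrite !coef_map /= /frobq -[q]expn1 (frob_iota iota).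
Qed.

(** For positive [n], the extension of degree [n] of [F] inside [C], as a list of roots. *)
Definition FQ n : seq C := projT1 (closed_field_poly_normal ('X^(q ^ n) - 'X : {poly C})).

Lemma q_eq0 : (q%:R : C) = 0.
Proof. by rewrite -(rmorph_nat iota) natF_eq0 rmorph0. Qed.

Lemma qn_gt1 n : (0 < n)%N -> (1 < q ^ n)%N.
Proof. by move=> n0; rewrite -(expn0 q) ltn_exp2l // fsize_gt1. Qed.

Lemma FQ_prod n : (0 < n)%N ->
  'X^(q ^ n) - 'X = \prod_(z <- FQ n) ('X - z%:P) :> {poly C}.
Proof.
move=> n0; rewrite /FQ; case: closed_field_poly_normal => s /= {1}->.
rewrite lead_coefDl ?lead_coefXn ?scale1r //.
by rewrite size_polyN size_polyX size_polyXn ltnS qn_gt1.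
Qed.

Lemma mem_FQ n x : (0 < n)%N -> (x \in FQ n) = (x ^+ (q ^ n) == x).
Proof.
move=> n0; rewrite -root_prod_XsubC -FQ_prod //.
by rewrite /root !hornerE subr_eq0.
Qed.

Lemma size_FQ n : (0 < n)%N -> size (FQ n) = (q ^ n)%N.
Proof.
move=> n0; have := congr1 (fun p : {poly C} => size p) (FQ_prod n0).
rewrite size_prod_XsubC size_polyDl ?size_polyXn; first by case.
by rewrite size_polyN size_polyX ltnS qn_gt1.
Qed.

Lemma uniq_FQ n : (0 < n)%N -> uniq (FQ n).
Proof.
move=> n0; rewrite -separable_prod_XsubC -FQ_prod // unlock.
rewrite derivB derivXn derivX -mulr_natr -polyC_natr natrX q_eq0 expr0n.
rewrite eqn0Ngt n0 mulr0 sub0r -[X in coprimep _ (- X)]scale1r -scaleNr.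
by rewrite coprimepZr ?coprimep1 // oppr_eq0 oner_eq0.
Qed.

Lemma iter_frobq n x : iter n frobq x = x ^+ (q ^ n).
Proof. by elim: n => //= n ->; rewrite /frobq -exprM -expnSr. Qed.

(** For [x] in [FQ k] this is the [k / e]-th power of the minimal polynomial of [x],
    where [e] is its degree. *)
Definition chib k x : {poly C} := \prod_(z <- traject frobq x k) ('X - z%:P).
Definition chi k x : {poly F} := map_poly emb_inv (chib k x).

Lemma chi_map k x : (0 < k)%N -> x \in FQ k -> (chi k x)^i = chib k x.
Proof.
move=> k0; rewrite mem_FQ // => /eqP hx; apply: poly_emb_invK.
rewrite /chib rmorph_prod /=.
under eq_bigr do rewrite rmorphB /= map_polyX map_polyC.
rewrite -(big_map frobq predT (fun z => 'X - z%:P)).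
case: k k0 hx => // k _ hx; rewrite [in RHS]trajectS.
(* Frobenius rotates the list of conjugates by one place, because [x] returns after [k] steps. *)
have -> : [seq frobq i | i <- traject frobq x k.+1] = rcons (traject frobq (frobq x) k) x.
  rewrite -[X in rcons _ X]hx -iter_frobq iterSr -trajectSr.
  by elim: k.+1 {hx} x => //= n IH x; rewrite IH.
by rewrite big_rcons big_cons mulrC.
Qed.

Lemma monic_chib k x : chib k x \is monic.
Proof. exact: monic_prod_XsubC. Qed.

Lemma size_chib k x : size (chib k x) = k.+1.
Proof. by rewrite size_prod_XsubC size_traject. Qed.

Lemma dvdp_prod_exp (s : seq C) (j : nat) (g : {poly C}) : uniq s ->
  (forall z, z \in s -> ('X - z%:P) ^+ j %| g) ->
  (\prod_(z <- s) ('X - z%:P)) ^+ j %| g.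
Proof.
elim: s => [|z s IH] /=; first by rewrite big_nil expr1n dvd1p.
case/andP=> zs us h; rewrite big_cons exprMn Gauss_dvdp.
  by rewrite h ?mem_head // IH // => y ys; rewrite h // inE ys orbT.
apply/coprimep_expl/coprimep_expr; rewrite coprimep_sym coprimep_XsubC.
by rewrite root_prod_XsubC.
Qed.

Section Orbit.
Variables (f : {poly F}) (m : nat) (rs : seq C).
Hypotheses (fm : f \is monic) (sf : size f = m.+1).
Hypothesis frs : f^i = \prod_(z <- rs) ('X - z%:P).

Lemma fi_neq0 : f^i != 0.
Proof. by rewrite map_poly_eq0 monic_neq0. Qed.

Lemma frobq_dvd i j x : ('X - x%:P) ^+ j %| f^i ->
  ('X - (iter i frobq x)%:P) ^+ j %| f^i.
Proof.
elim: i => //= i IH /IH; rewrite -(dvdp_map frobq) frobq_iota rmorphXn rmorphB /=.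
by rewrite map_polyX map_polyC.
Qed.

(** Let [e] be the length of the orbit of [x] and [c] its multiplicity in [f]. Then [x] lies in
    [FQ k] exactly when [e] divides [k], and [chib (e * j) x] is the [j]-th power of [chib e x],
    which divides [f] exactly when [j <= c]. So the indices counted are [e, 2 * e, ..., c * e], all
    at most [m]. *)
Lemma count_orbit x : x \in rs ->
  (\sum_(1 <= k < m.+1) ((x \in FQ k) && (chib k x %| f^i)%R) = count_mem x rs)%N.
Proof.
move=> xrs; set c := count_mem x rs.
have mupx : mup x f^i = c by rewrite frs mu_prod_XsubC.
have rx i : root f^i (iter i frobq x).
  rewrite -dvdp_XsubCl -['X - _]expr1 frobq_dvd // expr1 dvdp_XsubCl frs.
  by rewrite root_prod_XsubC.
have m_rs : size rs = m.
  have := congr1 (fun p : {poly C} => size p) frs.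
  by rewrite size_map_poly sf size_prod_XsubC => -[].
have iterI n : injective (iter n frobq).
  by elim: n => // n IH y z /= /fmorph_inj /IH.
have period j n : (j < n)%N -> iter n frobq x = iter j frobq x ->
    iter (n - j) frobq x = x.
  by move=> jn; rewrite -{1}(subnKC (ltnW jn)) iterD => /iterI.
have exe : exists e, (0 < e)%N && (iter e frobq x == x).
  have : ~~ uniq (traject frobq x m.+1).
    apply/negP => ut; have := max_poly_roots fi_neq0 _ ut.
    rewrite size_traject size_map_poly sf ltnn => H; apply/notF/H.
    by apply/allP => _ /trajectP[i _ ->].
  rewrite looping_uniq negbK => /trajectP[i im hi].
  by exists (m - i)%N; rewrite subn_gt0 im (period _ _ im hi) eqxx.
case: (ex_minnP exe) => e /andP[e_gt0 /eqP xe] e_min.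
have uP : uniq (traject frobq x e).
  rewrite -(prednK e_gt0) looping_uniq; apply/negP => /trajectP[i ie hi].
  have := e_min (e.-1 - i)%N; rewrite subn_gt0 ie (period _ _ ie hi) eqxx => /(_ isT).
  by lia.
have iter_mul j : iter (e * j) frobq x = x.
  by elim: j => [|j IH]; rewrite ?muln0 // mulnS iterD IH.
have FQe k : (0 < k)%N -> (x \in FQ k) = (e %| k)%N.
  move=> k0; rewrite mem_FQ // -iter_frobq; apply/eqP/idP => [hk|/dvdnP[j ->]].
    rewrite /dvdn; apply/negPn/negP => r0.
    have := e_min (k %% e)%N; rewrite lt0n r0 /=.
    rewrite {1}(divn_eq k e) addnC iterD mulnC iter_mul in hk.
    rewrite hk eqxx => /(_ isT); rewrite leqNgt ltn_mod e_gt0 //.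
  by rewrite mulnC iter_mul.
have chibM j : chib (e * j) x = chib e x ^+ j.
  elim: j => [|j IH]; first by rewrite muln0 /chib big_nil expr0.
  by rewrite mulnS /chib trajectD big_cat xe -!/(chib _ _) IH exprS.
have dvdE j : (chib (e * j) x %| f^i) = (j <= c)%N.
  rewrite chibM -mupx mup_geq ?fi_neq0 //; apply/idP/idP => [|hj].
    apply: dvdp_trans; apply: dvdp_exp2r; rewrite dvdp_XsubCl root_prod_XsubC.
    by rewrite -(prednK e_gt0) mem_head.
  by apply: dvdp_prod_exp => // _ /trajectP[i _ ->]; apply: frobq_dvd.
have ecm : (e * c <= m)%N.
  have := dvdp_leq fi_neq0 (_ : chib (e * c) x %| f^i).
  by rewrite dvdE size_chib size_map_poly sf; apply.
rewrite (eq_big_nat _ _ (F2 := fun k => ((e %| k) && (k <= e * c))%N : nat)); last first.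
  move=> k /andP[k0 _]; rewrite FQe //; case: dvdnP => //= -[j ->].
  by rewrite (mulnC j) dvdE leq_pmul2l.
rewrite (@big_cat_nat _ _ _ (e * c).+1) //= [X in (_ + X)%N](_ : _ = 0%N).
  rewrite addn0 (eq_big_nat _ _ (F2 := fun k => (e %| k)%N : nat)) => [|k].
    by rewrite -divn_count_dvd mulKn.
  by rewrite ltnS => /andP[_ ->]; rewrite andbT.
rewrite big_nat big1 // => k /andP[kc _].
by rewrite leqNgt kc andbF.
Qed.

(** The logarithmic derivative of the Euler product, for a single [f]. *)
Lemma sum_dvd_chib : 0 \notin rs ->
  (\sum_(1 <= k < m.+1) \sum_(x <- FQ k | (x != 0)%R) (chib k x %| f^i)%R = m)%N.
Proof.
move=> rs0; have m_rs : size rs = m.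
  have := congr1 (fun p : {poly C} => size p) frs.
  by rewrite size_map_poly sf size_prod_XsubC => -[].
have dvd_rs k x : (0 < k)%N -> chib k x %| f^i -> x \in rs.
  move=> k0 hd; rewrite -root_prod_XsubC -frs -dvdp_XsubCl; apply: dvdp_trans hd.
  by rewrite dvdp_XsubCl root_prod_XsubC -(prednK k0) mem_head.
have e1 k : (0 < k)%N -> (\sum_(x <- FQ k | (x != 0)%R) (chib k x %| f^i)%R =
    \sum_(x <- undup rs) ((x \in FQ k) && (chib k x %| f^i)%R))%N.
  move=> k0; transitivity (\sum_(x <- FQ k | x \in rs) (chib k x %| f^i)%R)%N.
    rewrite big_mkcond [RHS]big_mkcond; apply: eq_bigr => x _.
    case: ifP => [x0|/eqP->]; last by rewrite (negbTE rs0).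
    by case: ifPn => // xrs; apply/eqP; rewrite eqb0; apply: contraNN xrs; apply: dvd_rs.
  rewrite -big_filter; transitivity (\sum_(x <- [seq x <- undup rs | x \in FQ k])
      (chib k x %| f^i)%R)%N.
    apply: perm_big; apply: uniq_perm; rewrite ?filter_uniq ?undup_uniq ?uniq_FQ //.
    by move=> x; rewrite !mem_filter mem_undup andbC.
  rewrite big_filter big_mkcond; apply: eq_bigr => x _.
  by case: (x \in FQ k).
rewrite (eq_big_nat _ _ (F2 := fun k =>
    (\sum_(x <- undup rs) ((x \in FQ k) && (chib k x %| f^i)%R))%N)); last first.
  by move=> k /andP[k0 _]; apply: e1.
(* For a fixed root the sum over [k] is its multiplicity, and the multiplicities add up to the
   degree. *)
rewrite exchange_big /= -[RHS]m_rs -[RHS]sum1_size -[RHS]big_undup_iterop_count.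
apply: eq_big_seq => x; rewrite mem_undup => xrs.
by rewrite count_orbit // Monoid.iteropE iter_addn_0 mul1n.
Qed.
End Orbit.
End FixedField.

(** * Nontrivial additive characters of a finite field *)

Definition addchar (F : finFieldType) (psi : F -> algC) :=
  [/\ psi 0 = 1, forall x y, psi (x + y) = psi x * psi y & exists t, psi t != 1].

Section AddChar.
Variables (F : finFieldType) (psi : F -> algC).
Hypothesis hpsi : addchar psi.

Lemma addchar0 : psi 0 = 1. Proof. by case: hpsi. Qed.
Lemma addcharD x y : psi (x + y) = psi x * psi y. Proof. by case: hpsi. Qed.

Lemma addchar_scale c : c != 0 -> addchar (fun x => psi (c * x)).
Proof.
case: hpsi => p0 pD [t pt] c0; split; first by rewrite mulr0.
  by move=> x y; rewrite mulrDr pD.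
by exists (c^-1 * t); rewrite mulrA divff // mul1r.
Qed.

Lemma addcharN x : psi x * psi (- x) = 1.
Proof. by rewrite -addcharD subrr addchar0. Qed.

Lemma addchar_neq0 x : psi x != 0.
Proof. by apply/eqP => h; have /eqP := addcharN x; rewrite h mul0r eq_sym oner_eq0. Qed.

Lemma addchar_sum0 : \sum_x psi x = 0.
Proof.
case: hpsi => _ _ [t pt]; set s := \sum_x _.
have : psi t * s = s.
  rewrite /s mulr_sumr [RHS](reindex_inj (addrI t)) /=.
  by apply: eq_bigr => x _; rewrite addcharD.
move/eqP; rewrite -subr_eq0 -{2}[s]mul1r -mulrBl mulf_eq0 subr_eq0 (negbTE pt).
by move/eqP.
Qed.

Lemma addchar_norm x : `|psi x| = 1.
Proof.
have q0 := ltnW (fsize_gt1 F).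
have h n : psi (x *+ n) = psi x ^+ n.
  by elim: n => [|n IH]; rewrite ?addchar0 // mulrS exprS addcharD IH.
have : psi x ^+ fsize F = 1.
  by rewrite -h -mulr_natr natF_eq0 mulr0 addchar0.
move/(congr1 (fun z : algC => `|z|)); rewrite normrX normr1 => /eqP.
by rewrite pexpr_eq1 ?normr_ge0 // => /eqP.
Qed.

Lemma addchar_conj x : (psi x)^* = psi (- x).
Proof.
apply: (mulfI (addchar_neq0 x)); rewrite addcharN -normCK addchar_norm.
by rewrite expr1n.
Qed.

Lemma addchar_sum c : \sum_x psi (x * c) = if c == 0 then (fsize F)%:R else 0.
Proof.
case: eqP => [->|/eqP c0].
  rewrite (eq_bigr (fun=> 1)) => [|x _]; last by rewrite mulr0 addchar0.
  by rewrite sumr_const.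
by rewrite -[RHS]addchar_sum0 [RHS](reindex_inj (mulIf c0)).
Qed.

End AddChar.

(** * Coefficients of the L-function and Newton's identity *)

Section LFunction.
Variables (F : finFieldType) (C : closedFieldType) (iota : {rmorphism F -> C}).
Variables (psi : F -> algC) (a b : F).
Hypotheses (hpsi : addchar psi) (a0 : a != 0) (b0 : b != 0).
Local Notation q := (fsize F).
Local Notation "p ^i" := (map_poly iota p) (at level 2, format "p ^i") : ring_scope.

(** On monic polynomials this is completely multiplicative. The value [0] at multiples of ['X]
    excludes the root [0], where [b / z] has no meaning. *)
Definition lam (f : {poly F}) : algC := if f`_0 == 0 then 0 else psi (- logp a b f).

Lemma lamM f g : f \is monic -> g \is monic -> lam (f * g) = lam f * lam g.
Proof.
move=> mf mg; rewrite /lam coef0M mulf_eq0.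
have [f0|f0] /= := eqVneq f`_0 0; first by rewrite mul0r.
have [g0|g0] := eqVneq g`_0 0; first by rewrite mulr0.
by rewrite logpM // opprD (addcharD hpsi).
Qed.

Definition monp m (v : 'rV[F]_m) : {poly F} := 'X^m + rVpoly v.

Lemma size_monp m (v : 'rV[F]_m) : size (monp v) = m.+1.
Proof. by rewrite size_polyDl size_polyXn // ltnS size_poly. Qed.

Lemma monic_monp m (v : 'rV[F]_m) : monp v \is monic.
Proof.
by rewrite monicE lead_coefDl ?lead_coefXn // size_polyXn ltnS size_poly.
Qed.

Lemma monp_K m (f : {poly F}) : f \is monic -> size f = m.+1 ->
  monp (poly_rV (f - 'X^m) : 'rV_m) = f.
Proof. by move=> mf sf; rewrite /monp poly_rV_K ?size_monicB // addrC subrK. Qed.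

Lemma monpK m (v : 'rV[F]_m) : poly_rV (monp v - 'X^m) = v.
Proof. by rewrite /monp addrC addKr rVpolyK. Qed.

(** The coefficient of degree [m] of the L-function. *)
Definition Lsum m : algC := \sum_(v : 'rV[F]_m) lam (monp v).

(** Dividing by [g] matches the monic multiples of [g] of degree [m] with the monic polynomials of
    degree [m - k]. *)
Lemma Lsum_dvd m k (g : {poly F}) : (k <= m)%N -> g \is monic -> size g = k.+1 ->
  \sum_(v : 'rV[F]_m | g %| monp v) lam (monp v) = lam g * Lsum (m - k).
Proof.
move=> km mg sg; rewrite /Lsum mulr_sumr.
have sgm (w : 'rV[F]_(m - k)) : size (g * monp w) = m.+1.
  by rewrite size_monicM ?monic_neq0 ?monic_monp // sg size_monp addnS addSn subnKC.
have mgm (w : 'rV[F]_(m - k)) : g * monp w \is monic.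
  by rewrite monicMr ?monic_monp.
pose h (w : 'rV[F]_(m - k)) : 'rV[F]_m := poly_rV (g * monp w - 'X^m).
have hE w : monp (h w) = g * monp w by rewrite monp_K.
have hdiv (v : 'rV[F]_m) : g %| monp v ->
    monp (poly_rV (monp v %/ g - 'X^(m - k)) : 'rV_(m - k)) = monp v %/ g.
  move=> gv; have mq : monp v %/ g \is monic.
    by rewrite -(monicMr _ mg) divpK // monic_monp.
  rewrite monp_K // size_divp ?monic_neq0 // size_monp sg /= subSn //.
rewrite (reindex_onto h (fun v => poly_rV (monp v %/ g - 'X^(m - k)))) /=.
  apply: eq_big => [w|w _]; last by rewrite hE lamM ?monic_monp.
  by rewrite hE dvdp_mulr // mulrC mulpK ?monic_neq0 // monpK eqxx.
move=> v gv; rewrite /h hdiv // mulrC divpK // monpK //.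
Qed.

(** The Kloosterman sum over the extension of degree [k], in the form that the Euler product yields;
    [Ksum_trace] gives the usual form. *)
Definition Ksum k : algC := \sum_(x <- FQ F C k | x != 0) lam (chi iota k x).

Lemma chi_monic k x : (0 < k)%N -> x \in FQ F C k -> chi iota k x \is monic.
Proof.
move=> k0 xk; rewrite -(map_monic iota) chi_map //.
exact: monic_chib.
Qed.

Lemma size_chi k x : (0 < k)%N -> x \in FQ F C k -> size (chi iota k x) = k.+1.
Proof. by move=> k0 xk; rewrite -(size_map_poly iota) chi_map // size_chib. Qed.

(** Newton's identity. The factor [m] is written, for each monic polynomial, as the number of pairs
    [(k, x)] with [chi k x] dividing it; exchanging the sums leaves multiples of [chi k x],
    evaluated by [Lsum_dvd]. *)
Lemma newton m : m%:R * Lsum m = \sum_(1 <= k < m.+1) Ksum k * Lsum (m - k).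
Proof.
rewrite mulr_sumr.
have h (v : 'rV[F]_m) : m%:R * lam (monp v) = \sum_(1 <= k < m.+1)
    \sum_(x <- FQ F C k | x != 0) (chi iota k x %| monp v)%R%:R * lam (monp v).
  have [v0|v0] := eqVneq (monp v)`_0 0.
    rewrite /lam v0 eqxx mulr0 big1 // => k _; rewrite big1 // => x _.
    by rewrite mulr0.
  have [rs hrs] := closed_field_poly_normal (monp v)^i.
  rewrite lead_coef_map (monicP (monic_monp v)) rmorph1 scale1r in hrs.
  have rs0 : 0 \notin rs.
    by rewrite -root_prod_XsubC -hrs /root horner_coef0 coef_map fmorph_eq0.
  rewrite -{1}(sum_dvd_chib (monic_monp v) (size_monp v) hrs rs0).
  rewrite natr_sum mulr_suml big_nat [RHS]big_nat; apply: eq_bigr => k /andP[k0 _].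
  rewrite natr_sum mulr_suml big_seq_cond [RHS]big_seq_cond.
  apply: eq_bigr => x /andP[xk _]; rewrite -(chi_map iota k0 xk) dvdp_map //.
rewrite (eq_bigr _ (fun v _ => h v)) exchange_big /= big_nat [RHS]big_nat.
apply: eq_bigr => k /andP[k0 km]; rewrite exchange_big /= mulr_suml.
rewrite big_seq_cond [RHS]big_seq_cond; apply: eq_bigr => x /andP[xk x0].
rewrite -(Lsum_dvd (k := k)) ?chi_monic ?size_chi // [RHS]big_mkcond.
by apply: eq_bigr => v _; case: (_ %| _); rewrite ?mul1r ?mul0r.
Qed.

Lemma Lsum0 : Lsum 0 = 1.
Proof.
rewrite /Lsum (bigD1 0) //= big1 => [|v]; last by rewrite (thinmx0 v) eqxx.
rewrite /monp linear0 expr0 !addr0 /lam coef1 oner_eq0.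
by rewrite logp1 oppr0 (addchar0 hpsi).
Qed.

(** For the polynomial ['X^2 + y *: 'X + x] the character is linear in [y] with slope
    [- (a + b / x)]. Summing over [y] leaves only [x = - b / a]. *)
Lemma Lsum2 : Lsum 2 = q%:R.
Proof.
pose h (p : F * F) : 'rV[F]_2 := \row_i (if i == 0 then p.1 else p.2).
rewrite /Lsum (reindex h) /=; last first.
  exists (fun v : 'rV[F]_2 => (v 0 0, v 0 1)) => [[x y] _|v _].
    by rewrite /h !mxE.
  apply/rowP => i; rewrite !mxE /=; case: eqP => [->//|i0].
  suff -> : i = 1 by [].
  by apply/val_inj; case: i i0 => [[|[|n]] Hn] // i0; case: i0; apply/val_inj.
have e x y : lam (monp (h (x, y))) = if x == 0 then 0 else psi (y * (- (a + b / x))).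
  have hX : monp (h (x, y)) = 'X^2 + (x%:P + y *: 'X).
    congr (_ + _); apply/polyP => i; rewrite coef_rVpoly !coefE.
    case: insubP => [[k k2] /= _ /= <-|]; last first.
      by case: i => [|[|i]] //= _; rewrite !mulr0 addr0.
    rewrite mxE; case: k k2 => [|[|k]] //= k2; last by rewrite mulr1 add0r.
    by rewrite mulr0 addr0.
  rewrite /lam /logp size_monp /= hX !mulrDl !coefE /=.
  rewrite !(mulr0, add0r, addr0, mulr1); case: eqP => // _.
  by congr psi; ring.
rewrite -(pair_bigA _ (fun x y => lam (monp (h (x, y))))) /=.
rewrite (bigD1 (- b / a)) //= [X in _ + X]big1 ?addr0 => [|x xba].
  under eq_bigr do rewrite e.
  have ba0 : - b / a != 0 by rewrite mulf_neq0 ?oppr_eq0 ?invr_eq0.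
  rewrite (negbTE ba0) (addchar_sum hpsi).
  suff -> : - (a + b / (- b / a)) = 0 by rewrite eqxx.
  by field; rewrite a0 oppr_eq0 b0.
under eq_bigr do rewrite e.
have [x0|x0] := eqVneq x 0; first by rewrite big1.
rewrite (addchar_sum hpsi); case: eqP => // /eqP; rewrite oppr_eq0 => /eqP h0.
case/eqP: xba; apply: (mulIf a0); rewrite divfK //; apply: (mulIf (invr_neq0 x0)).
by rewrite -[LHS]addr0 -{1}[a](addrK (b / x)) h0; field; rewrite x0.
Qed.

(** Adding [t * 'X^m.-1] permutes the monic polynomials of degree [m] and
    multiplies [lam] by [psi (- (a * t))], as it leaves the two lowest
    coefficients alone. *)
Lemma Lsum_ge3 m : (2 < m)%N -> Lsum m = 0.
Proof.
case: m => [|[|[|n]]] // _; set m := n.+3.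
have [t pt] : exists t, psi (- (a * t)) != 1.
  case: hpsi => _ _ [t pt]; exists (- (a^-1 * t)).
  by rewrite mulrN opprK mulrA divff // mul1r.
pose d : 'rV[F]_m := t *: delta_mx 0 ord_max.
have hd v : monp (d + v) = monp v + t *: 'X^(n.+2).
  by rewrite /monp linearD /= linearZ /= rVpoly_delta /= -addrA [X in _ + X]addrC.
have : psi (- (a * t)) * Lsum m = Lsum m.
  rewrite [in RHS]/Lsum (reindex_inj (addrI d)) mulr_sumr.
  apply: eq_bigr => v _; rewrite hd /lam /logp size_monp.
  have -> : size (monp v + t *: 'X^(n.+2)) = m.+1 by rewrite -hd size_monp.
  move: (monp v) => r; rewrite mulrDl !coefE /= !(mulr0, addr0, mulr1).
  case: ifP => _; first by rewrite mulr0.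
  by rewrite -(addcharD hpsi) eqxx mulr1; congr psi; ring.
move/eqP; rewrite -subr_eq0 -{2}[Lsum m]mul1r -mulrBl mulf_eq0 subr_eq0 (negbTE pt).
by move/eqP.
Qed.

(** The L-function is the polynomial [1 + Ksum 1 * T + q * T ^ 2], so Newton's identity determines
    every [Ksum] from the first. *)
Lemma Ksum2 : Ksum 2 = 2 * q%:R - Ksum 1 ^+ 2.
Proof.
have := newton 1; rewrite big_nat1 subnn Lsum0 mul1r mulr1 => L1.
have := newton 2; rewrite big_nat_recl // big_nat1 subSS subn0 subnn Lsum0 Lsum2 L1 => ->.
by ring.
Qed.

Lemma Ksum_rec m : Ksum m.+3 = - (Ksum 1 * Ksum m.+2 + q%:R * Ksum m.+1).
Proof.
have := newton 1; rewrite big_nat1 subnn Lsum0 mul1r mulr1 => L1.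
have := newton m.+3; rewrite Lsum_ge3 // mulr0 big_nat_recr //= big_nat_recr //=.
rewrite big_nat_recr //= big_nat big1 ?add0r => [|k /andP[_ km]]; last first.
  by rewrite Lsum_ge3 ?mulr0 //; lia.
rewrite (_ : m.+3 - m.+1 = 2)%N; last by lia.
rewrite (_ : m.+3 - m.+2 = 1)%N; last by lia.
rewrite subnn Lsum0 Lsum2 L1 => h.
by apply/eqP; rewrite -subr_eq0; apply/eqP; rewrite [RHS]h; ring.
Qed.

(** For [u] in [FQ k] this is the trace to [F], seen inside [C]. *)
Definition frobtrace k (u : C) : C := \sum_(i < k) u ^+ (q ^ i).

Lemma Ksum_trace k : (0 < k)%N -> Ksum k =
  \sum_(x <- FQ F C k | x != 0) psi (emb_inv iota (frobtrace k (iota a * x + iota b / x))).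
Proof.
move=> k0; rewrite /Ksum big_seq_cond [RHS]big_seq_cond.
apply: eq_bigr => x /andP[xk x0].
have t0 : 0 \notin traject (@frobq F C) x k.
  apply/negP => /trajectP[i _ /esym/eqP].
  by rewrite iter_frobq expf_eq0 (negbTE x0) andbF.
have c0 : (chi iota k x)`_0 != 0.
  rewrite -(fmorph_eq0 iota) -coef_map chi_map //= -horner_coef0 -[_ == 0]/(root _ 0).
  by rewrite root_prod_XsubC.
rewrite /lam (negbTE c0); congr psi.
have <- : iota (- logp a b (chi iota k x)) = frobtrace k (iota a * x + iota b / x).
  rewrite rmorphN /logp rmorphD !rmorphM fmorphV -!coef_map rmorphM /= map_polyX.
  rewrite -(size_map_poly iota) chi_map //.
  rewrite -[_ + _]/(logp (iota a) (iota b) (chib F k x)) logp_prod // opprK.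
  rewrite (big_nth x) size_traject big_mkord; apply: eq_bigr => i _.
  rewrite nth_traject // iter_frobq (frobD iota) !exprMn exprVn !(frob_iota iota).
  by [].
by rewrite iotaK.
Qed.
End LFunction.

Definition kloos (F : finFieldType) (psi : F -> algC) (a b : F) : algC :=
  \sum_(x | x != 0) psi (a * x + b / x).

Section Kloosterman.
Variables (F : finFieldType) (C : closedFieldType) (iota : {rmorphism F -> C}).
Variables (psi : F -> algC) (a b : F).
Hypotheses (hpsi : addchar psi) (a0 : a != 0) (b0 : b != 0).
Local Notation q := (fsize F).

Lemma Ksum1 : Ksum iota psi a b 1 = kloos psi a b.
Proof.
rewrite Ksum_trace //.
have hp : perm_eq (FQ F C 1) [seq iota x | x <- enum F].
  apply: uniq_perm; [exact: uniq_FQ iota _ _| |].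
    by rewrite map_inj_uniq ?enum_uniq //; apply: fmorph_inj.
  move=> x; rewrite mem_FQ // expn1; apply/eqP/mapP => [/(@emb_invK F C iota) <-|[t _ ->]].
    by exists (emb_inv iota x) => //; rewrite mem_enum.
  by rewrite -[q]expn1 (frob_iota iota).
rewrite (perm_big _ hp) big_map big_enum_cond /=.
apply: eq_big => [x|x x0]; first by rewrite fmorph_eq0.
rewrite /frobtrace big_ord1 expr1 -fmorphV -!rmorphM -rmorphD iotaK.
by [].
Qed.

(** The two numbers are the reciprocal roots of the L-function, that is, the roots of
    [T ^ 2 + K * T + q]; their negated power sums obey the recurrence of [Ksum]. *)
Lemma Ksum_powers : exists al be : algC, [/\ al + be = - kloos psi a b,
  al * be = q%:R & forall n, (0 < n)%N -> Ksum iota psi a b n = - (al ^+ n + be ^+ n)].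
Proof.
set K := kloos psi a b; pose s := sqrtC (K ^+ 2 - 4 * q%:R).
have hs : s ^+ 2 = K ^+ 2 - 4 * q%:R by rewrite sqrtCK.
exists ((- K + s) / 2), ((- K - s) / 2).
have sumE : (- K + s) / 2 + (- K - s) / 2 = - K by field.
have prodE : (- K + s) / 2 * ((- K - s) / 2) = q%:R.
  rewrite -[LHS](_ : (K ^+ 2 - s ^+ 2) / 4 = _); last by field.
  by rewrite hs; field.
split=> //; set al := (_ + s) / 2 in sumE prodE *; set be := (_ - s) / 2 in sumE prodE *.
suff h n : Ksum iota psi a b n.+1 = - (al ^+ n.+1 + be ^+ n.+1) /\
           Ksum iota psi a b n.+2 = - (al ^+ n.+2 + be ^+ n.+2).
  by case=> // n _; case: (h n).
have KE : K = - (al + be) by rewrite sumE opprK.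
elim: n => [|n [IH1 IH2]].
  split; first by rewrite Ksum1 !expr1 -/K sumE opprK.
  by rewrite (Ksum2 _ hpsi) // Ksum1 -/K KE -prodE; ring.
split=> //; rewrite (Ksum_rec _ hpsi) // Ksum1 -/K KE IH1 IH2 -prodE !exprS.
by ring.
Qed.
End Kloosterman.

(** * Weil's bound for Kloosterman sums *)

Lemma bernoulli (e : algC) n : 0 <= e -> 1 + n%:R * e <= (1 + e) ^+ n.
Proof.
move=> e0; elim: n => [|n IH]; first by rewrite mul0r addr0 expr0.
rewrite exprS; apply: (@le_trans _ _ ((1 + e) * (1 + n%:R * e))).
  rewrite -natr1 -subr_ge0; have -> : (1 + e) * (1 + n%:R * e) - (1 + (n%:R + 1) * e)
    = n%:R * e * e by ring.
  by rewrite !mulr_ge0.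
by rewrite ler_pM2l ?IH // ltr_wpDr.
Qed.

Lemma norm_natrB_le (m n k : nat) :
  (m <= n + k)%N -> (n <= m + k)%N -> `|m%:R - n%:R : algC| <= k%:R.
Proof.
move=> h1 h2; have [mn|nm] := leqP m n.
  by rewrite distrC -natrB // normr_nat ler_nat leq_subLR.
by rewrite -natrB 1?ltnW // normr_nat ler_nat leq_subLR.
Qed.

(** A polynomial vanishing at the other terms turns a combination of the power sums
    into a multiple of [z ^ m]. *)
Lemma power_sum_bound (s : seq algC) (R A : algC) m0 : 0 < R ->
    (forall m, (m0 <= m)%N -> `|\sum_(z <- s) z ^+ m| <= A * R ^+ m) ->
  forall z, z \in s -> `|z| <= R.
Proof.
move=> R0 hs z zs.
have A0 : 0 <= A.
  by have := le_trans (normr_ge0 _) (hs m0 (leqnn _)); rewrite pmulr_lge0 // exprn_gt0.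
pose p := \prod_(y <- undup s | y != z) ('X - y%:P).
have pz : p.[z] != 0.
  rewrite horner_prod prodf_seq_neq0; apply/allP => y _ /=; apply/implyP => yz.
  by rewrite !hornerE subr_eq0 eq_sym.
have py y : y \in s -> y != z -> p.[y] = 0.
  move=> ys yz; rewrite /p -big_filter; apply/eqP; rewrite -[_ == 0]/(root _ y).
  by rewrite root_prod_XsubC mem_filter yz mem_undup.
pose c : algC := (count_mem z s)%:R * `|p.[z]|.
have c0 : 0 < c.
  by rewrite mulr_gt0 ?normr_gt0 // ltr0n -has_count has_pred1.
pose B := \sum_(k < size p) `|p`_k| * (A * R ^+ k).
have B0 : 0 <= B.
  by apply: sumr_ge0 => k _; rewrite !mulr_ge0 // exprn_ge0 // ltW.
have hm m : (m0 <= m)%N -> c * `|z| ^+ m <= B * R ^+ m.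
  move=> mm.
  have -> : c * `|z| ^+ m = `|\sum_(y <- s) y ^+ m * p.[y]|.
    rewrite (bigID (pred1 z)) /= [X in _ + X]big_seq_cond [X in _ + X]big1 ?addr0.
      rewrite (eq_bigr (fun=> z ^+ m * p.[z])) => [|y /eqP->//].
      rewrite big_const_seq iter_addr_0 -mulr_natl !normrM normr_nat normrX.
      by rewrite /c; ring.
    by move=> y /andP[ys yz]; rewrite py // mulr0.
  have -> : \sum_(y <- s) y ^+ m * p.[y] = \sum_(k < size p) p`_k * \sum_(y <- s) y ^+ (m + k).
    under eq_bigr do rewrite horner_coef mulr_sumr.
    rewrite exchange_big; apply: eq_bigr => k _; rewrite mulr_sumr.
    by apply: eq_bigr => y _; rewrite exprD; ring.
  rewrite (le_trans (ler_norm_sum _ _ _)) // mulr_suml ler_sum // => k _.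
  rewrite normrM -!mulrA ler_wpM2l // -exprD addnC.
  by apply: hs; rewrite (leq_trans mm) // leq_addl.
rewrite real_leNgt ?normr_real ?gtr0_real //; apply/negP => Rz.
(* If the modulus of [z] were [(1 + e) * R] with positive [e], Bernoulli's inequality would make
   [c * m * e] bounded in [m]. *)
pose e := `|z| / R - 1.
have e0 : 0 < e by rewrite subr_gt0 ltr_pdivlMr // mul1r.
have hb m : (m0 <= m)%N -> c * (m%:R * e) <= B.
  move=> mm; have := hm m mm.
  have -> : `|z| = (1 + e) * R by rewrite /e addrC subrK divfK // gt_eqF.
  rewrite exprMn mulrA ler_pM2r ?exprn_gt0 //; apply: le_trans.
  rewrite ler_pM2l //; apply: le_trans (bernoulli m (ltW e0)).
  by rewrite lerDr ler01.
have ce0 : 0 < c * e by rewrite mulr_gt0.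
have Bce : 0 <= B / (c * e) by rewrite divr_ge0 // ltW.
have := hb (maxn m0 (Num.bound (B / (c * e)))) (leq_maxl _ _).
rewrite mulrCA -ler_pdivlMr // real_leNgt ?realn ?ger0_real //.
case/negP; apply: (@lt_le_trans _ _ (Num.bound (B / (c * e)))%:R).
  exact: archi_boundP.
by rewrite ler_nat leq_maxr.
Qed.

Section Weil.
Variables (F : finFieldType) (C : closedFieldType) (iota : {rmorphism F -> C}).
Variables (psi : F -> algC) (a b : F).
Hypothesis oddF : odd (fsize F).
Hypotheses (hpsi : addchar psi) (a0 : a != 0) (b0 : b != 0).
Local Notation q := (fsize F).
Local Notation "p ^i" := (map_poly iota p) (at level 2, format "p ^i") : ring_scope.

Lemma frobtrace_sub n (y : C) : frobtrace F n (y ^+ q - y) = y ^+ (q ^ n) - y.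
Proof.
rewrite /frobtrace; elim: n => [|n IH]; first by rewrite big_ord0 expr1 subrr.
rewrite big_ord_recr /= IH (frobB iota) -exprM -expnS addrC subrKA.
by [].
Qed.

Lemma frobtrace_fixed n (u : C) : u ^+ (q ^ n) = u -> frobtrace F n u ^+ q = frobtrace F n u.
Proof.
move=> hu; rewrite /frobtrace -[X in _ ^+ X = _]expn1 (frob_sum iota).
under eq_bigr do rewrite -exprM -expnD addn1.
case: n hu => [|n] hu; first by rewrite !big_ord0.
by rewrite big_ord_recr /= hu [RHS]big_ord_recl /= expr1 addrC.
Qed.

(** The trace of [y ^ q - y] telescopes to [y ^ (q ^ n) - y]. It vanishes on [FQ n]; conversely, if
    [u] has trace zero, all [q] distinct roots of ['X^q - 'X - u] lie in [FQ n]. *)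
Lemma count_hilbert90 n (u : C) : (0 < n)%N -> u ^+ (q ^ n) = u ->
  count (fun y => y ^+ q - y == u) (FQ F C n) = (q * (frobtrace F n u == 0)%R)%N.
Proof.
move=> n0 hu; case: eqP => [tr0|tr0] /=; last first.
  rewrite muln0; apply/eqP; rewrite -leqn0 leqNgt -has_count; apply/hasPn => y.
  rewrite mem_FQ // => /eqP hy; apply/eqP => huy; apply: tr0.
  by rewrite -huy frobtrace_sub hy subrr.
rewrite muln1; pose p : {poly C} := 'X^q - 'X - u%:P.
have q1 := fsize_gt1 F.
have sp : size p = q.+1.
  rewrite /p -addrA size_polyDl size_polyXn // -opprD size_polyN ltnS.
  rewrite (leq_trans (size_polyD _ _)) // geq_max size_polyX size_polyC q1.
  by rewrite (leq_trans (leq_b1 _)) // ltnW.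
have [r hr] := closed_field_poly_normal p.
have lp : lead_coef p = 1.
  rewrite lead_coefE sp /p !coefE eqxx gtn_eqF // eqn0Ngt ltnW //.
  by rewrite !subr0.
rewrite lp scale1r in hr.
have sr : size r = q by apply/eqP; rewrite -eqSS -sp hr size_prod_XsubC.
have ur : uniq r.
  rewrite -separable_prod_XsubC -hr unlock !derivB derivXn derivX derivC subr0.
  rewrite -mulr_natr -polyC_natr (q_eq0 iota) mulr0 sub0r.
  rewrite -[X in coprimep _ (- X)]scale1r -scaleNr.
  by rewrite coprimepZr ?coprimep1 // oppr_eq0 oner_eq0.
have mr y : (y \in r) = (y ^+ q - y == u).
  by rewrite -root_prod_XsubC -hr /root !hornerE subr_eq0.
rewrite -[RHS]sr -size_filter; apply/perm_size/uniq_perm => //.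
  by rewrite filter_uniq // (uniq_FQ iota).
move=> y; rewrite mem_filter /= -mr mem_FQ // andb_idr // mr => /eqP huy.
by rewrite -subr_eq0 -frobtrace_sub huy tr0.
Qed.

Let c : F := 4 * a * b.

Lemma c_neq0 : c != 0.
Proof. by rewrite /c (_ : 4 = 2 * 2) ?mulf_neq0 ?two_neq0 //; ring. Qed.

Lemma i2_neq0 : (2 : C) != 0.
Proof. by rewrite -(rmorph_nat iota) fmorph_eq0 two_neq0. Qed.

(** A square root [w] of the discriminant [D] satisfies [w ^ (l * l) = w * E]. *)
Lemma count_quadratic m (y : C) : (0 < m)%N -> y \in FQ F C (m + m) ->
  let D := (stepD c)^i.[y] in let l := (q ^ m)%N in
  let E := D ^+ (l./2 * l.+1) in
  count (fun x => (x != 0) && (y ^+ q - y == iota a * x + iota b / x)) (FQ F C (m + m))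
    = ((D == 0)%R + 2 * (E == 1)%R)%N /\ [|| D == 0, E == 1 | E == -1].
Proof.
move=> m0 yQ D l E.
have hl x : x ^+ (q ^ (m + m)) = x ^+ (l * l) by rewrite expnD.
have mQ x : (x \in FQ F C (m + m)) = (x ^+ (l * l) == x).
  by rewrite mem_FQ ?addn_gt0 ?m0 // hl.
have fB (x z : C) : (x - z) ^+ (l * l) = x ^+ (l * l) - z ^+ (l * l).
  by rewrite -!hl (frobB iota).
have fD (x z : C) : (x + z) ^+ (l * l) = x ^+ (l * l) + z ^+ (l * l).
  by rewrite -!hl (frobD iota).
have fi (t : F) : iota t ^+ (l * l) = iota t by rewrite -hl (frob_iota iota).
move: yQ; rewrite mQ => /eqP yQ.
pose v := y ^+ q - y.
have vQ : v ^+ (l * l) = v by rewrite /v fB -exprM mulnC exprM yQ.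
have [w hw] : exists w, w ^+ 2 = D.
  have /closed_rootP[w] : size ('X^2 - D%:P) != 1 by rewrite size_XnsubC.
  by rewrite /root !hornerE subr_eq0 => /eqP hw; exists w.
have DE : D = v ^+ 2 - iota c.
  by rewrite /D map_stepD !hornerE.
have DQ : D ^+ (l * l) = D.
  by rewrite DE fB fi -exprM mulnC exprM vQ.
have ia0 : iota a != 0 by rewrite fmorph_eq0.
have ib0 : iota b != 0 by rewrite fmorph_eq0.
have ic : iota c = 4 * iota a * iota b by rewrite !rmorphM rmorph_nat.
have lodd : odd l by rewrite oddX oddF orbT.
(* So [E] is [D] to the power [(l * l - 1) / 2], the quadratic character of [D] in the field with
   [l * l] elements. *)
have lle : (l * l = (2 * (l./2 * l.+1)).+1)%N.
  by have := odd_double_half l; rewrite lodd -mul2n; move: (l./2) => h <-; rewrite add1n; ring.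
have wl : w ^+ (l * l) = w * E.
  by rewrite lle exprS exprM hw.
have E2 : D * E ^+ 2 = D by rewrite -exprM mulnC -exprS -lle.
pose r1 := (v + w) / (2 * iota a); pose r2 := (v - w) / (2 * iota a).
have i2 := i2_neq0.
have i4 : (4 : C) != 0 by rewrite (_ : 4 = 2 * 2) ?mulf_neq0 //; ring.
have solE x : ((x != 0) && (v == iota a * x + iota b / x)) = (x == r1) || (x == r2).
  have -> : (x == r1) || (x == r2) = (iota a * x ^+ 2 - v * x + iota b == 0).
    have -> : iota a * x ^+ 2 - v * x + iota b = iota a * ((x - r1) * (x - r2)).
      have -> : iota b = (v ^+ 2 - w ^+ 2) / (4 * iota a).
        by rewrite hw DE ic; field; rewrite i4 ia0.
      by rewrite /r1 /r2; field; rewrite ia0 i2.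
    by rewrite !mulf_eq0 (negbTE ia0) !subr_eq0.
  have [->|x0] /= := eqVneq x 0.
    by rewrite expr0n !mulr0 subrr add0r (negbTE ib0).
  rewrite -[LHS](inj_eq (mulIf x0)) -subr_eq0 -oppr_eq0.
  by congr (_ == 0); field.
have d2 : 2 * iota a != 0 by rewrite mulf_neq0.
have d2Q : (2 * iota a) ^+ (l * l) = 2 * iota a.
  by rewrite -(rmorph_nat iota) -rmorphM fi.
(* [v] and [2 * iota a] already lie in this field, so only the square root of [D] decides. *)
have rQ (e : C) : ((v + e) / (2 * iota a) \in FQ F C (m + m)) = (e ^+ (l * l) == e).
  rewrite mQ exprMn exprVn d2Q fD vQ.
  by rewrite (inj_eq (mulIf (invr_neq0 d2))) (inj_eq (addrI v)).
have r12 : (r1 == r2) = (w == 0).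
  rewrite (inj_eq (mulIf (invr_neq0 d2))) (inj_eq (addrI v)) -addr_eq0 -mulr2n.
  by rewrite -mulr_natr mulf_eq0 (negbTE i2) orbF.
have r1Q : (r1 \in FQ F C (m + m)) = (w * E == w) by rewrite rQ wl.
have r2Q : (r2 \in FQ F C (m + m)) = (w * E == w).
  by rewrite rQ -hl (frobN iota) hl wl eqr_opp.
have D0 : (D == 0) = (w == 0) by rewrite -hw expf_eq0.
have uQ : uniq (FQ F C (m + m)) by rewrite (uniq_FQ iota) // addn_gt0 m0.
split; last first.
  have [//|Dn0] /= := eqVneq D 0; move/eqP: E2; rewrite -{2}[D]mulr1.
  by rewrite (inj_eq (mulfI Dn0)) sqrf_eq1.
(* The exponent is positive; hence a double root is counted once, by the first summand alone. *)
have EzD : D = 0 -> E = 0.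
  move=> Dz; have l1 : (1 < l)%N by apply: qn_gt1.
  have Npos : (0 < l./2 * l.+1)%N.
    by rewrite muln_gt0 andbT half_gt0.
  by rewrite /E Dz expr0n eqn0Ngt Npos.
rewrite (eq_count solE).
clear fB fD fi hl mQ yQ vQ DQ DE lle wl E2 rQ solE; clearbody E l D.
have [Dz|Dn0] := eqVneq D 0.
  have wz : w = 0 by apply/eqP; rewrite -D0 Dz.
  have Ez : (E == 1) = false by rewrite EzD // eq_sym oner_eq0.
  have r12' : r1 = r2 by apply/eqP; rewrite r12 wz.
  rewrite Ez -r12' (eq_count (a2 := pred1 r1)) => [|x]; last by rewrite /= orbb.
  by rewrite count_uniq_mem // r1Q wz mul0r eqxx.
have wn0 : w != 0 by rewrite -D0.
rewrite -{2}[w]mulr1 (inj_eq (mulfI wn0)) in r1Q.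
rewrite -{2}[w]mulr1 (inj_eq (mulfI wn0)) in r2Q.
have := count_predUI (pred1 r1) (pred1 r2) (FQ F C (m + m)).
rewrite !count_uniq_mem // r1Q r2Q.
rewrite [count (predI _ _) _](_ : _ = 0%N); last first.
  apply/eqP; rewrite -leqn0 leqNgt -has_count; apply/hasPn => x _ /=.
  by apply/negP => /andP[/eqP-> /eqP h]; move: (r12); rewrite h eqxx (negbTE wn0).
by rewrite addn0 add0n mul2n -addnn => <-.
Qed.

Lemma count_stepD m : (2 < m)%N ->
  let D y := (stepD c)^i.[y] in let l := (q ^ m)%N in
  let E y := D y ^+ (l./2 * l.+1) in
  [/\ (count (fun y => D y == 0%R) (FQ F C (m + m)) <= 2 * q)%N,
      (2 * count (fun y => E y == 1%R) (FQ F C (m + m)) <= l * l + (4 * q + 6) * l)%N &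
      (2 * count (fun y => E y == (- 1)%R) (FQ F C (m + m)) <= l * l + (4 * q + 6) * l)%N].
Proof.
move=> m2 D l E; have m0 : (0 < m + m)%N by lia.
have uQ : uniq (FQ F C (m + m)) by rewrite (uniq_FQ iota).
have st e : e != 0 ->
    (2 * count (fun y => E y == iota e) (FQ F C (m + m)) <= l * l + (4 * q + 6) * l)%N.
  move=> e0; rewrite -size_filter.
  apply: (@stepanov F C iota oddF c c_neq0 m e) => //; first by rewrite filter_uniq.
  move=> y; rewrite mem_filter mem_FQ // expnD => /andP[/eqP hE /eqP hy].
  by split.
split.
- rewrite -size_filter -ltnS -(size_stepD oddF c_neq0) -(size_map_poly iota).
  apply: max_poly_roots; rewrite ?filter_uniq ?map_poly_eq0 ?(stepD_neq0 oddF) ?c_neq0 //.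
  by apply/allP => y; rewrite mem_filter => /andP[].
- by have := st 1 (oner_neq0 _); rewrite rmorph1.
- by have := st (- 1); rewrite oppr_eq0 oner_eq0 rmorphN1; apply.
Qed.

Definition twist (t : F) (x : F) : algC := psi (t * x).

(** For each [x], orthogonality turns the sum over [t != 0] into [q] times the indicator of trace
    zero, minus [1]; by Hilbert 90 the first term is the number of [y] above [x]. *)
Lemma sum_Ksum n : (0 < n)%N ->
  \sum_(t | t != 0) Ksum iota (twist t) a b n =
  (\sum_(y <- FQ F C n) count (fun x => (x != 0%R) &&
      (y ^+ q - y == iota a * x + iota b / x)%R) (FQ F C n))%:R - (q ^ n).-1%:R.
Proof.
move=> n0; have uQ : uniq (FQ F C n) by rewrite (uniq_FQ iota).
have card0 : (\sum_(x <- FQ F C n | x != 0%R) 1 = (q ^ n).-1)%N.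
  rewrite sum1_count -(size_FQ F C n0) -(count_predC (pred1 0) (FQ F C n)).
  by rewrite count_uniq_mem // mem_FQ // expr0n gtn_eqF ?card_fin_gt0 // eqxx.
rewrite -card0 (eq_bigr (fun t => \sum_(x <- FQ F C n | x != 0)
  twist t (emb_inv iota (frobtrace F n (iota a * x + iota b / x))))); last first.
  by move=> t t0; rewrite Ksum_trace.
rewrite exchange_big /=.
have hx x : x \in FQ F C n -> x != 0 ->
    \sum_(t | t != 0) twist t (emb_inv iota (frobtrace F n (iota a * x + iota b / x))) =
    (count (fun y => (y ^+ q - y == iota a * x + iota b / x)%R) (FQ F C n))%:R - 1.
  rewrite mem_FQ // => /eqP xQ x0; set u := _ + _.
  have uF : u ^+ (q ^ n) = u.
    by rewrite /u (frobD iota) !exprMn exprVn !(frob_iota iota) xQ.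
  rewrite count_hilbert90 //.
  have := addchar_sum hpsi (emb_inv iota (frobtrace F n u)).
  rewrite (bigD1 0) //= mul0r (addchar0 hpsi) addrC => /(canRL (addrK _)).
  rewrite /twist => ->; congr (_ - _).
  rewrite -(fmorph_eq0 iota) (emb_invK iota (frobtrace_fixed uF)).
  by case: eqP; rewrite ?muln1 ?muln0.
rewrite big_seq_cond (eq_bigr (fun x => (count (fun y =>
   (y ^+ q - y == iota a * x + iota b / x)%R) (FQ F C n))%:R - 1)); last first.
  by move=> x /andP[]; apply: hx.
rewrite -big_seq_cond sumrB !natr_sum; congr (_ - _).
rewrite -!natr_sum; congr _%:R.
under eq_bigr do rewrite -sum1_count big_mkcond.
rewrite exchange_big /=; apply: eq_bigr => y _.
by rewrite -sum1_count [RHS]big_mkcondr.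
Qed.

Lemma sum_Ksum_bound m : (2 < m)%N ->
  `|\sum_(t | t != 0) Ksum iota (twist t) a b (m + m)| <= (20 * q)%:R * q%:R ^+ m.
Proof.
move=> m2; have m0 : (0 < m)%N by lia.
rewrite sum_Ksum ?addn_gt0 ?m0 //; set s := FQ F C (m + m).
have us : uniq s by rewrite (uniq_FQ iota) // addn_gt0 m0.
pose D y := (stepD c)^i.[y]; pose l := (q ^ m)%N; pose E y := D y ^+ (l./2 * l.+1).
have [h0 hp hm] := count_stepD m2.
rewrite -/l -/s in h0 hp hm; rewrite -/(D _) in h0.
have -> : (\sum_(y <- s) count (fun x => (x != 0%R) &&
    (y ^+ q - y == iota a * x + iota b / x)%R) s =
    count (fun y => D y == 0%R) s + 2 * count (fun y => E y == 1%R) s)%N.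
  rewrite -!sum1_count big_distrr [X in (X + _)%N]big_mkcond.
  rewrite [X in (_ + X)%N]big_mkcond -big_split /=.
  apply: eq_big_seq => y ys; have [-> _] := count_quadratic m0 ys.
  by rewrite -/(D y) -/(E y); case: (D y == 0); case: (E y == 1).
(* Stepanov's method bounds only from above. Since every [y] falls in one of the three classes, the
   upper bound for [E = -1] gives the lower bound for [E = 1]. *)
have tot : (l * l <= count (fun y => D y == 0%R) s + count (fun y => E y == 1%R) s
    + count (fun y => E y == (- 1)%R) s)%N.
  rewrite -expnD -(size_FQ F C (n := m + m)) ?addn_gt0 ?m0 // -/s -sum1_size -!sum1_count.
  rewrite !(big_mkcond (fun y => _ == _)) -!big_split /= big_seq [X in (_ <= X)%N]big_seq.
  apply: leq_sum => y ys; have [_] := count_quadratic m0 ys.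
  by rewrite -/(D y) -/(E y); do 3 case: (_ == _).
have l1 : (1 < l)%N by apply: qn_gt1.
have q1 := fsize_gt1 F.
rewrite -natrX -/l -natrM expnD -/l.
move: (count _ s) (count _ s) (count _ s) h0 hp hm tot => N0 Np Nm h0 hp hm tot.
apply: norm_natrB_le.
  by nia.
by nia.
Qed.
End Weil.

(** The point count controls only the sum over all twists [t != 0], in even degrees [m + m]. Up to
    sign this is the [m]-th power sum of the squares of all [al] and [be], so [power_sum_bound]
    applies to each square. *)
Theorem kloos_bound (F : finFieldType) (psi : F -> algC) (a b : F) :
  odd (fsize F) -> addchar psi -> a != 0 -> b != 0 ->
  `|kloos psi a b| ^+ 2 <= 4 * (fsize F)%:R.
Proof.
move=> oddF hpsi a0 b0; set q := fsize F.
have [C [iota _]] := countable_algebraic_closure F.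
pose P (t : F) (p : algC * algC) := t != 0 -> [/\ p.1 + p.2 = - kloos (twist psi t) a b,
  p.1 * p.2 = q%:R & forall n, (0 < n)%N ->
  Ksum iota (twist psi t) a b n = - (p.1 ^+ n + p.2 ^+ n)].
(* The pair chosen at [t = 0] is a dummy, filtered out of [s] below. *)
have /fin_all_exists[r hr] : forall t, exists p, P t p.
  move=> t; have [->|t0] := eqVneq t 0; first by exists (0, 0); rewrite /P eqxx.
  have [al [be h]] := Ksum_powers iota (addchar_scale hpsi t0) a0 b0.
  by exists (al, be).
pose s := [seq (r t).1 ^+ 2 | t <- enum F & t != 0] ++
          [seq (r t).2 ^+ 2 | t <- enum F & t != 0].
have q0 : 0 < q%:R :> algC by rewrite ltr0n ltnW ?fsize_gt1.
have hs m : (3 <= m)%N -> `|\sum_(z <- s) z ^+ m| <= (20 * q)%:R * q%:R ^+ m.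
  move=> m3; apply: le_trans (sum_Ksum_bound iota oddF hpsi a0 b0 m3).
  rewrite -[leRHS]normrN -[in leRHS]sumrN big_cat !big_map !big_filter !big_enum_cond /=.
  rewrite -big_split /= le_eqVlt; apply/orP; left; apply/eqP; congr `|_|.
  apply: eq_bigr => t t0; have [_ _ ->] := hr t t0; last by lia.
  by rewrite opprK -!exprM mul2n addnn.
have bound z : z \in s -> `|z| <= q%:R by exact: (power_sum_bound q0 hs).
have o0 : (1 : F) != 0 := oner_neq0 F.
have [sumE _ _] := hr 1 o0.
have -> : kloos psi a b = - ((r 1).1 + (r 1).2).
  by rewrite sumE opprK; apply: eq_bigr => x _; rewrite /twist mul1r.
have in1 : 1 \in [seq t <- enum F | t != 0] by rewrite mem_filter o0 mem_enum.
have b1 : `|(r 1).1| ^+ 2 <= q%:R.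
  by rewrite -normrX bound // mem_cat (map_f (fun t => (r t).1 ^+ 2) in1).
have b2 : `|(r 1).2| ^+ 2 <= q%:R.
  by rewrite -normrX bound // mem_cat (map_f (fun t => (r t).2 ^+ 2) in1) orbT.
rewrite normrN; apply: (@le_trans _ _ ((`|(r 1).1| + `|(r 1).2|) ^+ 2)).
  by rewrite lerXn2r ?nnegrE ?addr_ge0 // ler_normD.
apply: (@le_trans _ _ (2 * (`|(r 1).1| ^+ 2 + `|(r 1).2| ^+ 2))).
  rewrite -subr_ge0; set x := `|_|; set y := `|_|.
  have -> : 2 * (x ^+ 2 + y ^+ 2) - (x + y) ^+ 2 = (x - y) ^+ 2 by ring.
  by rewrite real_exprn_even_ge0 // rpredB // normr_real.
have -> : 4 * q%:R = 2 * (q%:R + q%:R) :> algC by ring.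
by rewrite ler_pM2l // lerD.
Qed.

(** * Gauss sums *)

(** The additive group is abelian, so a nonprincipal irreducible character is linear; if it were
    constantly [1] it would be the principal one. *)
Lemma addchar_exists (F : finFieldType) : exists psi : F -> algC, addchar psi.
Proof.
pose G := [set: F]%G.
have abG : abelian G := FinRing.zmod_abelian _.
have N1 : (1 < Nirr G)%N.
  rewrite NirrE; have := abG; rewrite card_classes_abelian => /eqP ->.
  by rewrite cardsT finNzRing_gt1.
pose i : Iirr G := inord 1.
have i0 : i != 0 by rewrite -val_eqE /= inordK.
have li : 'chi_i \is a linear_char by exact: (char_abelianP G abG).
exists (fun x => 'chi_i x); split.
- exact: (lin_char1 li).
- by move=> x y; rewrite -(lin_charM li) ?inE.
apply/existsP; rewrite -[[exists _, _]]negbK negb_exists; apply/negP => /forallP h.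
case/eqP: i0; apply: irr_inj; rewrite irr0; apply/cfun_inP => x xG.
by rewrite cfun1E xG; apply/eqP; have := h x; rewrite negbK.
Qed.

Lemma sum_sqr_le (I : finType) (P : pred I) (x : I -> algC) :
  `|\sum_(i | P i) x i| ^+ 2 <= #|P|%:R * \sum_(i | P i) `|x i| ^+ 2.
Proof.
apply: (@le_trans _ _ ((\sum_(i | P i) `|x i|) ^+ 2)).
  by rewrite lerXn2r ?nnegrE ?sumr_ge0 // ler_norm_sum.
rewrite -subr_ge0; set r := fun i => `|x i|.
(* Lagrange's identity. *)
have -> : #|P|%:R * \sum_(i | P i) r i ^+ 2 - (\sum_(i | P i) r i) ^+ 2 =
    2^-1 * \sum_(i | P i) \sum_(j | P j) (r i - r j) ^+ 2.
  have -> : \sum_(i | P i) \sum_(j | P j) (r i - r j) ^+ 2 =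
     \sum_(i | P i) (\sum_(j | P j) (r i ^+ 2 + r j ^+ 2) - 2 * (r i * \sum_(j | P j) r j)).
    apply: eq_bigr => i _; rewrite !mulr_sumr -sumrB; apply: eq_bigr => j _.
    by ring.
  have -> : \sum_(i | P i) (\sum_(j | P j) (r i ^+ 2 + r j ^+ 2) -
        2 * (r i * \sum_(j | P j) r j)) =
      \sum_(i | P i) (#|P|%:R * r i ^+ 2 + \sum_(j | P j) r j ^+ 2) -
      2 * (\sum_(i | P i) r i) ^+ 2.
    rewrite sumrB expr2 mulr_suml mulr_sumr; congr (_ - _); apply: eq_bigr => i _.
    by rewrite big_split /= sumr_const mulr_natl.
  rewrite big_split /= -mulr_sumr sumr_const -[_ *+ #|_|]mulr_natl.
  by field.
rewrite mulr_ge0 ?invr_ge0 //; apply: sumr_ge0 => i _; apply: sumr_ge0 => j _.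
by rewrite real_exprn_even_ge0 // rpredB // normr_real.
Qed.

Lemma sum_rV_prod (F : finFieldType) d (G : 'I_d -> F -> algC) :
  \sum_(x : 'rV[F]_d) \prod_i G i (x 0 i) = \prod_i \sum_t G i t.
Proof.
rewrite bigA_distr_bigA (reindex (fun f : {ffun 'I_d -> F} => \row_i f i)) /=.
  by apply: eq_bigr => f _; apply: eq_bigr => i _; rewrite mxE.
exists (fun x : 'rV[F]_d => [ffun i => x 0 i]) => [f _|x _].
  by apply/ffunP => i; rewrite ffunE mxE.
by apply/rowP => i; rewrite mxE ffunE.
Qed.

Section Gauss.
Variables (F : finFieldType) (psi : F -> algC).
Hypothesis oddF : odd (fsize F).
Hypothesis hpsi : addchar psi.
Local Notation q := (fsize F).

Lemma psi_sum I (r : seq I) (P : pred I) (f : I -> F) :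
  psi (\sum_(i <- r | P i) f i) = \prod_(i <- r | P i) psi (f i).
Proof. exact: (big_morph psi (addcharD hpsi) (addchar0 hpsi)). Qed.

Definition fourier (f : F -> algC) (s : F) : algC := \sum_t f t * psi (s * t).

Lemma parseval f : \sum_s `|fourier f s| ^+ 2 = q%:R * \sum_t `|f t| ^+ 2.
Proof.
have e s : `|fourier f s| ^+ 2 = \sum_t \sum_u f t * (f u)^* * psi (s * (t - u)).
  rewrite normCK rmorph_sum mulr_suml; apply: eq_bigr => t _.
  rewrite mulr_sumr; apply: eq_bigr => u _.
  by rewrite rmorphM /= (addchar_conj hpsi) mulrBr (addcharD hpsi); ring.
under eq_bigr do rewrite e.
rewrite exchange_big mulr_sumr /=; apply: eq_bigr => t _.
rewrite exchange_big (bigD1 t) //= [X in _ + X]big1 ?addr0 => [|u ut].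
  rewrite -mulr_sumr (addchar_sum hpsi) subrr eqxx normCK; ring.
rewrite -mulr_sumr (addchar_sum hpsi) subr_eq0 eq_sym (negbTE ut) mulr0 //.
Qed.

Definition gauss (v : F) : algC := \sum_t psi (v * t ^+ 2).

Lemma gauss_norm v : v != 0 -> `|gauss v| ^+ 2 = q%:R.
Proof.
move=> v0; rewrite normCK rmorph_sum mulr_sumr.
(* Writing the second variable as [y + h] makes the phase linear in [y], so only [h = 0]
   survives. *)
transitivity (\sum_y \sum_h psi (v * h ^+ 2) * psi (y * (2 * v * h))).
  apply: eq_bigr => y _; rewrite mulr_suml (reindex_inj (addrI y)).
  apply: eq_bigr => h _; rewrite /= (addchar_conj hpsi) -!(addcharD hpsi).
  by congr psi; ring.
rewrite exchange_big (bigD1 0) //= [X in _ + X]big1 ?addr0 => [|h h0].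
  by rewrite -mulr_sumr (addchar_sum hpsi) !mulr0 eqxx expr0n mulr0 (addchar0 hpsi) mul1r.
rewrite -mulr_sumr (addchar_sum hpsi) !mulf_eq0 (negbTE h0) (negbTE v0).
by rewrite (negbTE (two_neq0 oddF)) mulr0.
Qed.

Lemma card_sqrt_le2 (z : F) : (#|[pred x | x ^+ 2 == z]| <= 2)%N.
Proof.
have [x0 /eqP hx|] := pickP [pred x | x ^+ 2 == z]; last by move=> h; rewrite eq_card0.
rewrite (leq_trans (n := #|pred2 x0 (- x0)|)) //; last by rewrite card2; case: eqP.
by apply: subset_leq_card; apply/subsetP => x; rewrite !inE -hx eqf_sqr.
Qed.

(** If [v] is not a square, the values of [x ^ 2] and [v * x ^ 2] together cover
    every element exactly twice, so [gauss 1 + gauss v = 0]. *)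
Lemma gauss_sqr v : v != 0 -> gauss v ^+ 2 = gauss 1 ^+ 2.
Proof.
move=> v0; case: (pickP [pred t | t ^+ 2 == v]) => [t /eqP tv|nsq].
  have t0 : t != 0 by apply: contraNneq v0 => t0; rewrite -tv t0 expr0n.
  congr (_ ^+ 2); rewrite /gauss [RHS](reindex_inj (mulfI t0)).
  by apply: eq_bigr => x _; rewrite mul1r exprMn tv.
pose n1 z := #|[pred x : F | x ^+ 2 == z]|; pose n2 z := #|[pred x : F | v * x ^+ 2 == z]|.
have gE (w : F) : gauss w = \sum_z #|[pred x : F | w * x ^+ 2 == z]|%:R * psi z.
  rewrite /gauss (partition_big (fun x => w * x ^+ 2) predT) //=.
  apply: eq_bigr => z _; rewrite (eq_bigr (fun=> psi z)) => [|x /eqP->//].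
  by rewrite sumr_const mulr_natl.
have tot (w : F) : (\sum_z #|[pred x : F | (w * x ^+ 2 == z)%R]| = q)%N.
  rewrite [RHS]/fsize -[RHS]sum1_card [RHS](partition_big (fun x => w * x ^+ 2) predT) //=.
  by apply: eq_bigr => z _; rewrite -sum1_card; apply: eq_bigl => x; rewrite !inE.
have le2 z : (n1 z + n2 z <= 2)%N.
  have [->|z0] := eqVneq z 0.
    rewrite /n1 /n2 (eq_card (B := pred1 0)) => [|x]; last by rewrite !inE expf_eq0.
    rewrite (@eq_card _ _ (pred1 0)) ?card1 // => x.
    by rewrite !inE mulf_eq0 (negbTE v0) expf_eq0.
  have [x /eqP hx|h1] := pickP [pred x : F | x ^+ 2 == z]; last first.
    rewrite /n1 eq_card0 // add0n /n2 (leq_trans _ (card_sqrt_le2 (z / v))) //.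
    apply: subset_leq_card; apply/subsetP => x; rewrite !inE => /eqP <-.
    by rewrite mulrC mulKf.
  rewrite /n2 (@eq_card0 _ [pred x : F | v * x ^+ 2 == z]) ?addn0 ?card_sqrt_le2 // => y.
  rewrite !inE; apply/negP => /eqP hy.
  have y0 : y != 0 by apply: contraNneq z0 => y0; rewrite -hy y0 expr0n mulr0.
  have := nsq (x / y); rewrite /= expr_div_n hx -hy mulfK ?eqxx //.
  by rewrite expf_eq0.
have eq2 z : (n1 z + n2 z = 2)%N.
  apply/eqP; rewrite eqn_leq le2 /= leqNgt; apply/negP => lt2.
  have : (\sum_z (n1 z + n2 z) < \sum_(z : F) 2)%N.
    rewrite (bigD1 z) //= [X in (_ < X)%N](bigD1 z) //= -addSn leq_add //.
    by apply: leq_sum.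
  rewrite big_split sum_nat_const /= tot.
  have -> : (\sum_z n1 z = q)%N.
    by rewrite -[RHS](tot 1); apply: eq_bigr => y _; apply: eq_card => x; rewrite !inE mul1r.
  by rewrite -[#|_|]/(fsize F) addnn -muln2 ltnn.
have : gauss 1 + gauss v = 0.
  rewrite !gE -big_split /= -[RHS](mulr0 2) -[in RHS](addchar_sum0 hpsi) [RHS]mulr_sumr.
  apply: eq_bigr => z _; rewrite -mulrDl -natrD; congr (_%:R * _).
  by rewrite -[RHS](eq2 z) /n1; congr (_ + _)%N; apply: eq_card => x; rewrite !inE mul1r.
by move/eqP; rewrite addrC addr_eq0 => /eqP ->; rewrite sqrrN.
Qed.

End Gauss.

(** * The energy bound for large [A] *)

Section VectorSums.
Variables (F : finFieldType) (psi : F -> algC).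
Hypothesis oddF : odd (fsize F).
Hypothesis hpsi : addchar psi.
Variable d : nat.
Hypothesis evend : ~~ odd d.
Local Notation q := (fsize F).
Local Notation g := (gauss psi 1 ^+ d).
Implicit Types a b : 'rV[F]_d.

Lemma sum_psi_neq0 z : \sum_(s | s != 0) psi (s * z) = (q * (z == 0%R))%N%:R - 1.
Proof.
have := addchar_sum hpsi z; rewrite (bigD1 0) //= mul0r (addchar0 hpsi) addrC.
by move=> /(canRL (addrK _)) ->; case: eqP; rewrite ?muln1 ?muln0.
Qed.

Lemma sum_neq0_const (z : algC) : \sum_(s : F | s != 0) z = q.-1%:R * z.
Proof.
rewrite big_const iter_addr_0 mulr_natl; congr (_ *+ _).
by rewrite -[RHS](cardC1 (0 : F)); apply: eq_card.
Qed.

(** For even [d] only the square of the Gauss sum enters, and this does not depend on [v]. *)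
Lemma gauss_even v : v != 0 -> gauss psi v ^+ d = g.
Proof.
by move=> v0; rewrite -(even_halfK evend) -mul2n !exprM (gauss_sqr hpsi v0).
Qed.

Lemma norm_gauss_even : `|g| ^+ 2 = (q ^ d)%N%:R.
Proof. by rewrite normrX -exprM mulnC exprM (gauss_norm oddF hpsi) ?oner_neq0 // natrX. Qed.

Lemma qdistC a b : qdist a b = qdist b a.
Proof. by apply: eq_bigr => i _; ring. Qed.

Lemma gauss_shift v u w : v != 0 ->
  \sum_t psi (v * t ^+ 2 + u * t + w) = psi (w - u ^+ 2 / (4 * v)) * gauss psi v.
Proof.
move=> v0; rewrite /gauss mulr_sumr (reindex_inj (addIr (- u / (2 * v)))) /=.
apply: eq_bigr => t _; rewrite -(addcharD hpsi); congr psi.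
have two0 := two_neq0 oddF.
have four0 : (4 : F) != 0 by rewrite (_ : 4 = 2 * 2) ?mulf_neq0 //; ring.
by field; rewrite v0 two0 four0.
Qed.

(** The squares of the coordinates of [a] cancel between the two distances, so [v] is the only
    quadratic coefficient and each coordinate gives a Gauss sum. *)
Lemma sum_dist_shift v s b b' : v != 0 ->
  \sum_(a : 'rV[F]_d) psi (v * \sum_i a 0 i ^+ 2 + s * (qdist a b - qdist a b')) =
  psi (s * (\sum_i b 0 i ^+ 2 - \sum_i b' 0 i ^+ 2) - s ^+ 2 / v * qdist b b') * g.
Proof.
move=> v0; have two0 := two_neq0 oddF.
have four0 : (4 : F) != 0 by rewrite (_ : 4 = 2 * 2) ?mulf_neq0 //; ring.
transitivity (\sum_(a : 'rV[F]_d) \prod_i psi (v * (a 0 i) ^+ 2 +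
    (2 * s * (b' 0 i - b 0 i)) * a 0 i + s * (b 0 i ^+ 2 - b' 0 i ^+ 2))).
  apply: eq_bigr => a _; rewrite -(psi_sum hpsi); congr psi.
  rewrite /qdist -sumrB !mulr_sumr -big_split; apply: eq_bigr => i _ /=.
  by ring.
rewrite (sum_rV_prod (fun i t => psi (v * t ^+ 2 +
    (2 * s * (b' 0 i - b 0 i)) * t + s * (b 0 i ^+ 2 - b' 0 i ^+ 2)))).
under eq_bigr do rewrite gauss_shift //.
rewrite big_split /= prodr_const card_ord (gauss_even v0); congr (_ * _).
rewrite -(psi_sum hpsi) /qdist; congr psi.
rewrite -sumrB !mulr_sumr -sumrB; apply: eq_bigr => i _.
by field; rewrite v0 four0.
Qed.

Lemma sum_dist_gram s s' a a' : s != s' ->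
  \sum_(b : 'rV[F]_d) psi (s * qdist a b - s' * qdist a' b) =
  g * psi (- (s * s' / (s - s') * qdist a a')).
Proof.
rewrite -subr_eq0 => v0; have two0 := two_neq0 oddF.
have four0 : (4 : F) != 0 by rewrite (_ : 4 = 2 * 2) ?mulf_neq0 //; ring.
transitivity (\sum_(b : 'rV[F]_d) \prod_i psi ((s - s') * (b 0 i) ^+ 2 +
    (- 2 * (s * a 0 i - s' * a' 0 i)) * b 0 i + (s * a 0 i ^+ 2 - s' * a' 0 i ^+ 2))).
  apply: eq_bigr => b _; rewrite -(psi_sum hpsi); congr psi.
  rewrite /qdist !mulr_sumr -sumrB; apply: eq_bigr => i _ /=.
  by ring.
rewrite (sum_rV_prod (fun i t => psi ((s - s') * t ^+ 2 +
    (- 2 * (s * a 0 i - s' * a' 0 i)) * t + (s * a 0 i ^+ 2 - s' * a' 0 i ^+ 2)))).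
under eq_bigr do rewrite gauss_shift //.
rewrite big_split /= prodr_const card_ord (gauss_even v0) mulrC; congr (_ * _).
rewrite -(psi_sum hpsi) /qdist; congr psi.
rewrite mulr_sumr -sumrN; apply: eq_bigr => i _.
by field; rewrite v0 four0.
Qed.

(** With equal parameters the phase is linear in [b], and orthogonality applies in each
    coordinate. *)
Lemma sum_dist_diag s a a' : s != 0 ->
  \sum_(b : 'rV[F]_d) psi (s * qdist a b - s * qdist a' b) = (q ^ d * (a == a'))%N%:R.
Proof.
move=> s0; have two0 := two_neq0 oddF.
transitivity (\sum_(b : 'rV[F]_d) \prod_i (psi (s * (a 0 i ^+ 2 - a' 0 i ^+ 2)) *
    psi (b 0 i * (- 2 * s * (a 0 i - a' 0 i))))).
  apply: eq_bigr => b _; under [RHS]eq_bigr do rewrite -(addcharD hpsi).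
  rewrite -(psi_sum hpsi); congr psi.
  rewrite /qdist !mulr_sumr -sumrB; apply: eq_bigr => i _ /=.
  by ring.
rewrite (sum_rV_prod (fun i t => psi (s * (a 0 i ^+ 2 - a' 0 i ^+ 2)) *
    psi (t * (- 2 * s * (a 0 i - a' 0 i))))).
under eq_bigr do rewrite -mulr_sumr (addchar_sum hpsi).
have [<-|/eqP aa] := eqVneq a a'.
  under eq_bigr do rewrite !subrr !mulr0 eqxx (addchar0 hpsi) mul1r.
  by rewrite prodr_const card_ord muln1 natrX.
rewrite muln0; apply/eqP/prodf_eq0.
case: (pickP (fun i => a 0 i != a' 0 i)) => [i ai|h]; last first.
  by case: aa; apply/rowP => i; apply/eqP; have := h i; case: eqP.
exists i => //.
have nz : - 2 * s * (a 0 i - a' 0 i) != 0.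
  by rewrite !mulf_neq0 ?oppr_eq0 ?subr_eq0.
by rewrite (negbTE nz) mulr0.
Qed.


Section Counting.
Variables A B : {set 'rV[F]_d}.

Definition dist_count (t : F) : nat := \sum_(a in A) \sum_(b in B) (qdist a b == t).

Lemma sum_dist_count : (\sum_t dist_count t = #|A| * #|B|)%N.
Proof.
rewrite /dist_count exchange_big /= -sum_nat_const; apply: eq_bigr => a _.
rewrite exchange_big /= -sum1_card; apply: eq_bigr => b _.
by rewrite (bigD1 (qdist a b)) //= eqxx big1 // => t /negbTE; rewrite eq_sym => ->.
Qed.

Lemma sum_dist_count_fun (f : F -> algC) :
  \sum_t (dist_count t)%:R * f t = \sum_(a in A) \sum_(b in B) f (qdist a b).
Proof.
transitivity (\sum_t \sum_(a in A) \sum_(b in B) (qdist a b == t)%:R * f t).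
  apply: eq_bigr => t _; rewrite natr_sum mulr_suml; apply: eq_bigr => a _.
  by rewrite natr_sum mulr_suml.
rewrite exchange_big /=; apply: eq_bigr => a _.
rewrite exchange_big /=; apply: eq_bigr => b _.
rewrite (bigD1 (qdist a b)) //= eqxx mul1r big1 ?addr0 // => t /negbTE.
by rewrite eq_sym => ->; rewrite mul0r.
Qed.

Definition dist_fourier s : algC := \sum_(a in A) \sum_(b in B) psi (s * qdist a b).

Lemma dist_fourierE s : fourier psi (fun t => (dist_count t)%:R) s = dist_fourier s.
Proof. exact: (sum_dist_count_fun (fun t => psi (s * t))). Qed.

Lemma dist_fourier0 : dist_fourier 0 = (#|A| * #|B|)%N%:R.
Proof.
rewrite /dist_fourier (eq_bigr (fun=> #|B|%:R)) => [|a _].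
  by rewrite sumr_const natrM mulr_natl.
rewrite (eq_bigr (fun=> 1)) => [|b _]; last by rewrite mul0r (addchar0 hpsi).
by rewrite sumr_const.
Qed.

(** The indicator of the sphere is expanded in characters with frequency [v]. The term [v = 0] gives
    the diagonal; the others give [g] times a count of roots of a quadratic. *)
Lemma sphere_pair_bound (j : F) b b' : j != 0 ->
  `|\sum_(s | s != 0) \sum_(a in sphere d j) psi (s * (qdist a b - qdist a b'))|
    <= (q ^ d * (b == b'))%N%:R + 2 * `|g|.
Proof.
move=> j0; set W := \sum_(s | _) _; have q1 := fsize_gt1 F.
pose dl := \sum_i b 0 i ^+ 2 - \sum_i b' 0 i ^+ 2; pose ep := qdist b b'.
pose rt := #|[pred w : F | (w != 0) && (dl - w * j - ep / w == 0)]|.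
have rt2 : (rt <= 2)%N.
  have inj : injective (fun w : F => 2 * j * w - dl).
    by move=> x y /= /addIr /mulfI; apply; rewrite mulf_neq0 // two_neq0.
  (* The condition is [j * w ^ 2 - dl * w + ep = 0], and [2 * j * w - dl] is a square root of its
     discriminant. *)
  rewrite /rt -(card_image inj); apply: leq_trans (card_sqrt_le2 (dl ^+ 2 - 4 * j * ep)).
  apply: subset_leq_card; apply/subsetP => z /imageP[w].
  rewrite inE => /andP[w0 /eqP h] ->; rewrite inE -subr_eq0.
  have -> : (2 * j * w - dl) ^+ 2 - (dl ^+ 2 - 4 * j * ep) =
    - (4 * j * w) * (dl - w * j - ep / w) by field.
  by rewrite h mulr0.
have qW : q%:R * W = (q.-1 * (q ^ d * (b == b')))%N%:R + g * ((q * rt)%N%:R - q.-1%:R).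
  have sph s : q%:R * \sum_(a in sphere d j) psi (s * (qdist a b - qdist a b')) =
      \sum_v \sum_(a : 'rV[F]_d) psi (v * (\sum_i a 0 i ^+ 2 - j)) *
        psi (s * (qdist a b - qdist a b')).
    rewrite exchange_big /= mulr_sumr big_mkcond; apply: eq_bigr => a _.
    rewrite -mulr_suml (addchar_sum hpsi) subr_eq0 inE.
    by case: eqP => // _; rewrite mul0r.
  rewrite mulr_sumr; under eq_bigr do rewrite sph (bigD1 0) //=.
  rewrite big_split /=; congr (_ + _).
    rewrite (eq_bigr (fun=> (q ^ d * (b == b'))%N%:R)) => [|s s0].
      by rewrite sum_neq0_const -natrM.
    rewrite -(sum_dist_diag b b' s0); apply: eq_bigr => a _.
    by rewrite mul0r (addchar0 hpsi) mul1r mulrBr !(qdistC a).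
  transitivity (\sum_(s | s != 0) \sum_(w | w != 0) g * psi (s * (dl - w * j - ep / w))).
    apply: eq_bigr => s s0.
    (* The substitution [v = s * w] makes the phase linear in [s]. *)
    rewrite (reindex_inj (mulfI s0)) /=; apply: eq_big => [w|w].
      by rewrite mulf_eq0 (negbTE s0).
    rewrite mulf_eq0 (negbTE s0) /= => w0.
    under eq_bigr do rewrite -(addcharD hpsi) mulrBr addrAC (addcharD hpsi).
    rewrite -mulr_suml sum_dist_shift ?mulf_neq0 // mulrC mulrCA mulrA -(addcharD hpsi).
    rewrite mulrC -/ep -/dl; congr (_ * psi _).
    by field; rewrite w0 s0.
  rewrite exchange_big /=.
  under eq_bigr do rewrite -mulr_sumr sum_psi_neq0.
  rewrite -mulr_sumr sumrB sum_neq0_const mulr1; congr (_ * (_ - _)).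
  rewrite -natr_sum; congr _%:R; rewrite -big_distrr /= /rt -sum1_card.
  congr (_ * _)%N; rewrite [RHS]big_mkcond [LHS]big_mkcond; apply: eq_bigr => w _.
  by rewrite !inE; case: (w != 0); case: (_ == 0).
have q0 : 0 < q%:R :> algC by rewrite ltr0n ltnW.
rewrite -(ler_pM2l q0) -{1}[q%:R]normr_nat -normrM qW.
rewrite (le_trans (ler_normD _ _)) // [leRHS]mulrDr lerD //.
  by rewrite normr_nat -natrM ler_nat leq_mul // leq_pred.
rewrite normrM mulrC mulrA ler_wpM2r // -natrM mulnC.
by apply: norm_natrB_le; nia.
Qed.

(** By Parseval the left side is a sum over frequencies [s]. The three terms come from [s = 0], from
    the diagonal [b = b'], and from the bound [2 * |g|] for every pair, where the size of [A] gives
    [|g| <= #|A|]. *)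
Lemma large_case_energy (j : F) : j != 0 -> A \subset sphere d j -> (q ^ d <= #|A| ^ 2)%N ->
  (q * \sum_t dist_count t ^ 2 <=
   (#|A| * #|B|) ^ 2 + #|A| * (q ^ d * #|B|) + #|A| * (2 * #|B| ^ 2 * #|A|))%N.
Proof.
move=> j0 hA hAq.
have gA : `|g| <= #|A|%:R.
  rewrite -(@ler_pXn2r _ 2) ?nnegrE //.
  by rewrite norm_gauss_even -natrX ler_nat.
rewrite -(ler_nat algC) natrM natr_sum.
have -> : q%:R * \sum_t ((dist_count t ^ 2)%N%:R : algC) = \sum_s `|dist_fourier s| ^+ 2.
  under [RHS]eq_bigr do rewrite -dist_fourierE.
  rewrite (parseval hpsi); congr (_ * _); apply: eq_bigr => t _.
  by rewrite normr_nat natrX.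
rewrite (bigD1 0) //= dist_fourier0 normr_nat -natrX -addnA natrD lerD2l.
pose W b b' : algC := \sum_(s | s != 0) \sum_(a in sphere d j) psi (s * (qdist a b - qdist a b')).
pose T : algC := \sum_(s : F | s != 0) \sum_(a in sphere d j)
  `|\sum_(b in B) psi (s * qdist a b)| ^+ 2.
have T0 : 0 <= T.
  by apply: sumr_ge0 => s _; apply: sumr_ge0 => a _; rewrite exprn_ge0.
have TE : T = \sum_(b in B) \sum_(b' in B) W b b'.
  rewrite /T (eq_bigr (fun s => \sum_(b in B) \sum_(b' in B)
      \sum_(a in sphere d j) psi (s * (qdist a b - qdist a b')))) => [|s _].
    by rewrite exchange_big; apply: eq_bigr => b _; rewrite exchange_big.
  rewrite (eq_bigr (fun a => \sum_(b in B) \sum_(b' in B)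
      psi (s * (qdist a b - qdist a b')))) => [|a _].
    by rewrite exchange_big; apply: eq_bigr => b _; rewrite exchange_big.
  rewrite normCK rmorph_sum mulr_suml; apply: eq_bigr => b _.
  rewrite mulr_sumr; apply: eq_bigr => b' _.
  by rewrite /= (addchar_conj hpsi) mulrBr (addcharD hpsi).
apply: (@le_trans _ _ (#|A|%:R * T)).
  rewrite mulr_sumr; apply: ler_sum => s _.
  apply: le_trans (sum_sqr_le _ _) _; rewrite ler_wpM2l //.
  rewrite [leRHS](bigID (fun a => a \in A)) /= -[leLHS]addr0 lerD //.
    rewrite le_eqVlt; apply/orP; left; apply/eqP; apply: eq_bigl => a.
    by rewrite andb_idl // => /(subsetP hA).
  by apply: sumr_ge0 => a _; rewrite exprn_ge0.
rewrite -mulnDr natrM ler_wpM2l // -(ger0_norm T0) TE.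
apply: (@le_trans _ _ (\sum_(b in B) \sum_(b' in B) ((q ^ d * (b == b'))%N%:R + 2 * #|A|%:R))).
  apply: le_trans (ler_norm_sum _ _ _) _; apply: ler_sum => b _.
  apply: le_trans (ler_norm_sum _ _ _) _; apply: ler_sum => b' _.
  by apply: le_trans (sphere_pair_bound b b' j0) _; rewrite lerD2l ler_pM2l.
rewrite (eq_bigr (fun b => (q ^ d)%N%:R + #|B|%:R * (2 * #|A|%:R))) => [|b bB].
  rewrite sumr_const -[leLHS]mulr_natl -(natrM _ 2) -natrM -natrD -natrM ler_nat.
  by rewrite leq_eqVlt; apply/orP; left; apply/eqP; ring.
rewrite big_split /= sumr_const; congr (_ + _); last by rewrite [RHS]mulr_natl.
rewrite -natr_sum (bigD1 b) //= eqxx muln1 big1 ?addn0 // => b' /andP[_ /negbTE].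
by rewrite eq_sym => ->; rewrite muln0.
Qed.
End Counting.
End VectorSums.

(** * The energy bound for small [A] *)

Section Toeplitz.
Variables (F : finFieldType) (psi : F -> algC).
Hypothesis oddF : odd (fsize F).
Hypothesis hpsi : addchar psi.
Local Notation q := (fsize F).
Local Notation kappa := (2 * sqrtC q%:R : algC).

Lemma kappa_ge1 : 1 <= kappa.
Proof.
rewrite -(@ler_pXn2r _ 2) ?nnegrE ?mulr_ge0 ?sqrtC_ge0 ?ler0n //.
rewrite exprMn sqrtCK expr1n -natrX -natrM ler1n.
by have := fsize_gt1 F; lia.
Qed.

Lemma kloos_norm r x : x != 0 -> `|kloos psi r x| <= kappa.
Proof.
move=> x0; have [->|r0] := eqVneq r 0.
  (* At [r = 0] the sum degenerates to that of a nontrivial character over nonzero elements. *)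
  suff -> : kloos psi 0 x = - 1 by rewrite normrN1 kappa_ge1.
  have := sum_psi_neq0 hpsi x; rewrite (negbTE x0) muln0 sub0r => <-.
  rewrite /kloos (reindex_inj (@invr_inj F)) /=; apply: eq_big => [h|h _].
    by rewrite invr_eq0.
  by rewrite mul0r add0r invrK mulrC.
rewrite -(@ler_pXn2r _ 2) ?nnegrE ?mulr_ge0 ?sqrtC_ge0 ?ler0n //.
rewrite exprMn sqrtCK -natrX; exact: kloos_bound.
Qed.

Lemma fourier_sqr f r : `|fourier psi f r| ^+ 2 =
  \sum_u \sum_w f u * (f w)^* * psi (r * (u - w)).
Proof.
rewrite normCK rmorph_sum mulr_suml; apply: eq_bigr => t _.
rewrite mulr_sumr; apply: eq_bigr => u _.
by rewrite rmorphM /= (addchar_conj hpsi) mulrBr (addcharD hpsi); ring.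
Qed.

(** The condition [h = u - w] is written as a sum of characters over [r]; then the sums over [u] and
    [w] separate from the one over [h]. *)
Lemma toeplitz_diag f x :
  q%:R * \sum_u \sum_(w | w != u) f u * (f w)^* * psi (x / (u - w)) =
  \sum_r `|fourier psi f r| ^+ 2 * kloos psi (- r) x.
Proof.
transitivity (\sum_u \sum_w \sum_(h | h != 0) f u * (f w)^* * psi (x / h) *
    \sum_r psi (r * (u - w - h))).
  rewrite mulr_sumr; apply: eq_bigr => u _; rewrite mulr_sumr [LHS]big_mkcond.
  apply: eq_bigr => w _.
  under eq_bigr do rewrite (addchar_sum hpsi).
  have [->|wu] /= := eqVneq w u.
    rewrite big1 // => h h0; rewrite subrr sub0r oppr_eq0 (negbTE h0).
    by rewrite mulr0.
  rewrite (bigD1 (u - w)) /=; last by rewrite subr_eq0 eq_sym.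
  rewrite subrr eqxx big1 ?addr0 1?mulrC // => h /andP[_ h1].
  by rewrite [_ - h == 0]subr_eq0 eq_sym (negbTE h1) mulr0.
under [RHS]eq_bigr do rewrite fourier_sqr mulr_suml.
rewrite [RHS]exchange_big /=; apply: eq_bigr => u _.
under [RHS]eq_bigr do rewrite mulr_suml.
rewrite [RHS]exchange_big /=; apply: eq_bigr => w _.
under [RHS]eq_bigr do rewrite mulr_sumr.
rewrite [RHS]exchange_big /=; apply: eq_bigr => h _.
rewrite mulr_sumr; apply: eq_bigr => r _.
by rewrite mulrBr -mulNr !(addcharD hpsi); ring.
Qed.

(** In the coordinate [1 / s] this Hermitian form is a Toeplitz form, whose
    eigenvalues are Kloosterman sums. *)
Definition hform (m : F -> algC) x : algC :=
  \sum_s \sum_(s' | s' != s) m s * (m s')^* * psi (- (s * s' / (s - s') * x)).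

Lemma hform_bound m x : m 0 = 0 -> x != 0 ->
  `|hform m x| <= kappa * \sum_s `|m s| ^+ 2.
Proof.
move=> m0 x0; have q0 : 0 < q%:R :> algC by rewrite ltr0n (ltnW (fsize_gt1 F)).
pose f u := m u^-1.
have -> : hform m x = \sum_u \sum_(w | w != u) f u * (f w)^* * psi (x / (u - w)).
  rewrite /hform (reindex_inj (@invr_inj F)) /=; apply: eq_bigr => u _.
  rewrite (reindex_inj (@invr_inj F)) /=; apply: eq_big => [w|w].
    by rewrite (inj_eq (@invr_inj F)).
  rewrite (inj_eq (@invr_inj F)) => wu; rewrite -/(f u) -/(f w).
  (* Since [0^-1 = 0], inversion permutes [F]; the terms at [0] vanish by [m 0 = 0], and elsewhere
     [- s * s' / (s - s')] becomes [1 / (u - w)]. *)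
  have [->|u0] := eqVneq u 0; first by rewrite {1 3}/f invr0 m0 !mul0r.
  have [->|w0] := eqVneq w 0; first by rewrite {2 4}/f invr0 m0 conjC0 !(mulr0, mul0r).
  congr (_ * psi _); field.
  by rewrite w0 u0 mulN1r !subr_eq0 [u == w]eq_sym wu.
have -> : \sum_s `|m s| ^+ 2 = \sum_u `|f u| ^+ 2.
  by rewrite (reindex_inj (@invr_inj F)).
rewrite -(ler_pM2l q0) -{1}[q%:R]normr_nat -normrM toeplitz_diag mulrCA -(parseval hpsi).
apply: le_trans (ler_norm_sum _ _ _) _; rewrite mulr_sumr; apply: ler_sum => r _.
by rewrite normrM normrX normr_id mulrC ler_wpM2r ?exprn_ge0 ?kloos_norm.
Qed.

Lemma hform0 m : `|hform m 0| <= `|\sum_s m s| ^+ 2 + \sum_s `|m s| ^+ 2.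
Proof.
suff -> : hform m 0 = `|\sum_s m s| ^+ 2 - \sum_s `|m s| ^+ 2.
  rewrite (le_trans (ler_normB _ _)) // lerD // ger0_norm ?exprn_ge0 //.
  by apply: sumr_ge0 => s _; rewrite exprn_ge0.
rewrite normCK rmorph_sum mulr_suml -sumrB; apply: eq_bigr => s _.
rewrite mulr_sumr [in RHS](bigD1 s) //= normCK [RHS]addrAC subrr add0r.
by apply: eq_bigr => s' _; rewrite mulr0 oppr0 (addchar0 hpsi) mulr1.
Qed.

End Toeplitz.

Section SmallCase.
Variables (F : finFieldType) (psi : F -> algC).
Hypothesis oddF : odd (fsize F).
Hypothesis hpsi : addchar psi.
Variable d : nat.
Hypothesis evend : ~~ odd d.
Variables A B : {set 'rV[F]_d}.
Local Notation q := (fsize F).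
Local Notation g := (gauss psi 1 ^+ d).
Local Notation kappa := (2 * sqrtC q%:R : algC).
Local Notation X := (#|A| * #|B|)%N.
Local Notation nu := (dist_count A B).

Definition nz_energy : nat := \sum_(t | t != 0) nu t ^ 2.
Definition nz_count : nat := \sum_(t | t != 0) nu t.

(** Expanding the square, the pairs [s = s'] give the first term by [sum_dist_diag] and the pairs
    [s != s'] the second by [sum_dist_gram]. *)
Lemma sum_form_sqr (m : F -> algC) : m 0 = 0 ->
  \sum_(b : 'rV[F]_d) `|\sum_s m s * \sum_(a in A) psi (s * qdist a b)| ^+ 2 =
  (q ^ d * #|A|)%N%:R * (\sum_s `|m s| ^+ 2) +
  g * \sum_(a in A) \sum_(a' in A) hform psi m (qdist a a').
Proof.
move=> m0.
transitivity (\sum_s \sum_s' m s * (m s')^* * \sum_(a in A) \sum_(a' in A)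
    \sum_(b : 'rV[F]_d) psi (s * qdist a b - s' * qdist a' b)).
  transitivity (\sum_(b : 'rV[F]_d) \sum_s \sum_s' m s * (m s')^* *
      \sum_(a in A) \sum_(a' in A) psi (s * qdist a b - s' * qdist a' b)).
    apply: eq_bigr => b _; rewrite normCK rmorph_sum mulr_suml.
    apply: eq_bigr => s _; rewrite mulr_sumr; apply: eq_bigr => s' _.
    rewrite rmorphM rmorph_sum /= mulrACA; congr (_ * _).
    rewrite mulr_suml; apply: eq_bigr => a _; rewrite mulr_sumr.
    by apply: eq_bigr => a' _; rewrite (addchar_conj hpsi) -(addcharD hpsi).
  rewrite exchange_big; apply: eq_bigr => s _ /=.
  rewrite exchange_big; apply: eq_bigr => s' _ /=.
  rewrite -mulr_sumr; congr (_ * _); rewrite exchange_big; apply: eq_bigr => a _ /=.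
  by rewrite exchange_big.
have -> : g * \sum_(a in A) \sum_(a' in A) hform psi m (qdist a a') =
    \sum_s \sum_(s' | s' != s) m s * (m s')^* * \sum_(a in A) \sum_(a' in A)
     \sum_(b : 'rV[F]_d) psi (s * qdist a b - s' * qdist a' b).
  transitivity (\sum_(a in A) \sum_(a' in A) \sum_s \sum_(s' | s' != s)
      m s * (m s')^* * \sum_(b : 'rV[F]_d) psi (s * qdist a b - s' * qdist a' b)).
    rewrite mulr_sumr; apply: eq_bigr => a _; rewrite mulr_sumr; apply: eq_bigr => a' _.
    rewrite mulr_sumr; apply: eq_bigr => s _; rewrite mulr_sumr; apply: eq_bigr => s' ss'.
    by rewrite sum_dist_gram // 1?eq_sym //; ring.
  under eq_bigr do rewrite exchange_big /=.
  rewrite exchange_big /=; apply: eq_bigr => s _.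
  under eq_bigr do rewrite exchange_big /=.
  rewrite exchange_big /=; apply: eq_bigr => s' _.
  by rewrite mulr_sumr; apply: eq_bigr => a _; rewrite mulr_sumr.
rewrite mulr_sumr -big_split; apply: eq_bigr => s _ /=.
rewrite (bigD1 s) //=; congr (_ + _).
have [->|s0] := eqVneq s 0; first by rewrite m0 normr0 expr0n mul0r mulr0 mul0r.
rewrite -normCK mulrC; congr (_ * _).
rewrite (eq_bigr (fun a => (q ^ d)%N%:R)) => [|a aA].
  by rewrite sumr_const mulnC natrM mulr_natl.
rewrite (bigD1 a) //= [X in _ + X]big1 ?addr0 => [|a' /andP[_ /negbTE aa]].
  by rewrite sum_dist_diag // eqxx muln1.
by rewrite sum_dist_diag // eq_sym aa muln0.
Qed.


Lemma dist_fourier_swap (m : F -> algC) :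
  \sum_s m s * dist_fourier psi A B s =
  \sum_(b in B) \sum_s m s * \sum_(a in A) psi (s * qdist a b).
Proof.
rewrite [RHS]exchange_big; apply: eq_bigr => s _ /=.
by rewrite -mulr_sumr /dist_fourier exchange_big.
Qed.

(** Since the distance [0] is dropped, the Fourier coefficients [M s] sum to [0];
    this is what controls the pairs [a, a'] with [qdist a a' = 0]. *)
Lemma small_case_energy : (#|A| ^ 2 * q <= q ^ d)%N ->
  `|(q * nz_energy)%N%:R - (nz_count * X)%N%:R : algC| ^+ 2 <=
    (3 * q ^ d * X * (q * nz_energy))%N%:R.
Proof.
move=> hA; pose mu (t : F) : algC := if t == 0 then 0 else (nu t)%:R.
(* The sign makes the sum of [M s * dist_fourier s] a Parseval pairing; [m] omits the frequency [0],
   which carries the main term [nz_count * X]. *)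
pose M s := fourier psi mu (- s); pose m s := if s == 0 then 0 else M s.
set QE := (q * nz_energy)%N%:R : algC.
have QE0 : 0 <= QE by rewrite ler0n.
have M0 : M 0 = nz_count%:R.
  rewrite /M oppr0 /fourier natr_sum [RHS]big_mkcond; apply: eq_bigr => t _.
  by rewrite mul0r (addchar0 hpsi) mulr1 /mu; case: eqP.
have sumM : \sum_s M s = 0.
  rewrite exchange_big big1 // => t _.
  rewrite -mulr_sumr (eq_bigr (fun s => psi (s * - t))) => [|s _]; last by rewrite mulrN mulNr.
  rewrite (addchar_sum hpsi) oppr_eq0 /mu; case: eqP; rewrite ?mul0r ?mulr0 //.
have normM : \sum_s `|M s| ^+ 2 = QE.
  rewrite (reindex_inj (@oppr_inj F)) /=; under eq_bigr do rewrite /M opprK.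
  rewrite (parseval hpsi) /QE natrM natr_sum [in RHS]big_mkcond; congr (_ * _).
  apply: eq_bigr => t _; rewrite /mu; case: eqP => _ /=; first by rewrite normr0 expr0n.
  by rewrite normr_nat natrX.
have sumMV : \sum_s M s * dist_fourier psi A B s = QE.
  transitivity (\sum_t \sum_u mu t * (nu u)%:R * \sum_s psi (s * (u - t))).
    transitivity (\sum_s \sum_t \sum_u mu t * (nu u)%:R * psi (s * (u - t))).
      apply: eq_bigr => s _; rewrite -dist_fourierE mulr_suml.
      apply: eq_bigr => t _; rewrite mulr_sumr; apply: eq_bigr => u _.
      by rewrite mulrBr mulNr (addcharD hpsi); ring.
    rewrite exchange_big; apply: eq_bigr => t _ /=.
    by rewrite exchange_big; apply: eq_bigr => u _; rewrite mulr_sumr.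
  rewrite /QE natrM natr_sum [in RHS]big_mkcond [RHS]mulr_sumr; apply: eq_bigr => t _.
  rewrite (bigD1 t) //= [X in _ + X]big1 ?addr0 => [|u ut]; last first.
    by rewrite (addchar_sum hpsi) subr_eq0 (negbTE ut) mulr0.
  rewrite (addchar_sum hpsi) subrr eqxx mulrC /mu; case: eqP; rewrite ?mul0r ?mulr0 //.
  by move=> _; rewrite natrX expr2.
have m0 : m 0 = 0 by rewrite /m eqxx.
have diffE : QE - (nz_count * X)%N%:R = \sum_s m s * dist_fourier psi A B s.
  rewrite -sumMV (bigD1 0) //= M0 (dist_fourier0 hpsi) -natrM [LHS]addrAC subrr add0r.
  rewrite [RHS](bigD1 0) //= m0 mul0r add0r.
  by apply: eq_bigr => s /negbTE s0; rewrite /m s0.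
have normm : `|nz_count%:R : algC| ^+ 2 + \sum_s `|m s| ^+ 2 = QE.
  rewrite -normM [RHS](bigD1 0) //= M0; congr (_ + _).
  rewrite (bigD1 0) //= m0 normr0 expr0n add0r.
  by apply: eq_bigr => s /negbTE s0; rewrite /m s0.
have summ : \sum_s m s = - nz_count%:R.
  apply/eqP; rewrite -addr_eq0 addrC; apply/eqP; rewrite -[RHS]sumM [RHS](bigD1 0) //= M0.
  congr (_ + _); rewrite (bigD1 0) //= m0 add0r.
  by apply: eq_bigr => s /negbTE s0; rewrite /m s0.
have Y0 : 0 <= \sum_s `|m s| ^+ 2 by apply: sumr_ge0 => s _; rewrite exprn_ge0.
have YQE : \sum_s `|m s| ^+ 2 <= QE by rewrite -normm lerDr exprn_ge0.
have k0 : 0 <= kappa by rewrite (le_trans ler01) // kappa_ge1.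
have hf x : `|hform psi m x| <= kappa * QE.
  have [->|x0] := eqVneq x 0.
    apply: le_trans (hform0 hpsi m) _; rewrite summ normrN normm.
    by rewrite -{1}[QE]mul1r ler_wpM2r // kappa_ge1.
  by apply: le_trans (hform_bound oddF hpsi m0 x0) _; rewrite ler_wpM2l.
(* [|g|] is [q ^ (d / 2)] and Weil's bound costs [2 * sqrt q], which is exactly what the size of [A]
   absorbs. *)
have gk : `|g| * kappa * #|A|%:R <= (2 * q ^ d)%N%:R.
  rewrite -(@ler_pXn2r _ 2) ?nnegrE ?mulr_ge0 ?sqrtC_ge0 ?ler0n //.
  rewrite !exprMn (norm_gauss_even oddF hpsi) sqrtCK -!natrX -!natrM ler_nat.
  by move: hA; move: (q ^ d)%N #|A| (q) => x y z; nia.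
apply: (@le_trans _ _ (`|\sum_s m s * dist_fourier psi A B s| ^+ 2)).
  by rewrite -diffE.
rewrite dist_fourier_swap.
apply: le_trans (sum_sqr_le _ _) _.
have -> : (3 * q ^ d * X * (q * nz_energy))%N%:R =
    #|B|%:R * ((q ^ d * #|A|)%N%:R * QE + (2 * q ^ d)%N%:R * #|A|%:R * QE).
  by rewrite /QE !natrM; ring.
rewrite ler_wpM2l //.
pose w (b : 'rV[F]_d) := `|\sum_s m s * \sum_(a in A) psi (s * qdist a b)| ^+ 2.
apply: (@le_trans _ _ (\sum_b w b)).
  rewrite [leRHS](bigID (fun b => b \in B)) /= lerDl.
  by apply: sumr_ge0 => b _; rewrite exprn_ge0.
rewrite -[leLHS]ger0_norm; last by apply: sumr_ge0 => b _; rewrite exprn_ge0.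
rewrite sum_form_sqr // (le_trans (ler_normD _ _)) // lerD //.
  by rewrite normrM normr_nat ler_wpM2l // ger0_norm.
rewrite normrM; apply: (@le_trans _ _ (`|g| * (#|A|%:R * (#|A|%:R * (kappa * QE))))).
  rewrite ler_wpM2l //; apply: le_trans (ler_norm_sum _ _ _) _.
  rewrite [leRHS]mulr_natl -sumr_const; apply: ler_sum => a _.
  apply: le_trans (ler_norm_sum _ _ _) _.
  by rewrite [leRHS]mulr_natl -sumr_const; apply: ler_sum.
have -> : `|g| * (#|A|%:R * (#|A|%:R * (kappa * QE))) =
  (`|g| * kappa * #|A|%:R) * (#|A|%:R * QE) by ring.
by rewrite -[leRHS]mulrA ler_wpM2r // mulr_ge0.
Qed.

(** Cauchy-Schwarz over [B], extension to the whole space, and orthogonality at equal parameters. *)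
Lemma dist_fourier_bound s : s != 0 ->
  `|dist_fourier psi A B s| ^+ 2 <= (q ^ d * X)%N%:R.
Proof.
move=> s0; rewrite /dist_fourier exchange_big /=.
apply: le_trans (sum_sqr_le _ _) _.
rewrite mulnA (mulnC _ #|B|) natrM ler_wpM2l //.
pose w (b : 'rV[F]_d) := `|\sum_(a in A) psi (s * qdist a b)| ^+ 2.
apply: (@le_trans _ _ (\sum_b w b)).
  rewrite [leRHS](bigID (fun b => b \in B)) /= lerDl.
  by apply: sumr_ge0 => b _; rewrite exprn_ge0.
rewrite le_eqVlt; apply/orP; left; apply/eqP.
transitivity (\sum_(a in A) \sum_(a' in A) \sum_(b : 'rV[F]_d)
    psi (s * qdist a b - s * qdist a' b)).
  transitivity (\sum_(b : 'rV[F]_d) \sum_(a in A) \sum_(a' in A)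
      psi (s * qdist a b - s * qdist a' b)).
    apply: eq_bigr => b _; rewrite /w normCK rmorph_sum mulr_suml.
    apply: eq_bigr => a _; rewrite mulr_sumr; apply: eq_bigr => a' _.
    by rewrite /= (addchar_conj hpsi) -(addcharD hpsi).
  rewrite exchange_big; apply: eq_bigr => a _ /=.
  by rewrite exchange_big.
rewrite (eq_bigr (fun a => (q ^ d)%N%:R)) => [|a aA].
  by rewrite sumr_const natrM mulr_natr.
rewrite (bigD1 a) //= [X in _ + X]big1 ?addr0 => [|a' /andP[_ /negbTE aa]].
  by rewrite sum_dist_diag // eqxx muln1.
by rewrite sum_dist_diag // eq_sym aa muln0.
Qed.

(** As [16 = 4 ^ 2], each nonzero frequency contributes at most [X / 4] in absolute value. *)
Lemma zero_count_bound :
  (16 * q ^ d <= X)%N -> (4 * (q * nu 0%R) <= 4 * X + q.-1 * X)%N.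
Proof.
move=> hX.
have E : (q * nu 0%R)%N%:R - X%:R = \sum_(s | s != 0) dist_fourier psi A B s.
  have <- : \sum_s dist_fourier psi A B s = (q * nu 0%R)%N%:R.
    under eq_bigr do rewrite -dist_fourierE.
    rewrite exchange_big (bigD1 0) //= [X in _ + X]big1 ?addr0 => [|t t0].
      by rewrite -mulr_sumr (addchar_sum hpsi) eqxx natrM mulrC.
    by rewrite -mulr_sumr (addchar_sum hpsi) (negbTE t0) mulr0.
  by rewrite (bigD1 0) //= (dist_fourier0 hpsi) addrAC subrr add0r.
suff key : 4 * ((q * nu 0%R)%N%:R - X%:R) <= (q.-1 * X)%N%:R :> algC.
  by move: key; rewrite mulrBr lerBlDl -!natrM -natrD ler_nat.
have b1 s : s != 0 -> 4 * `|dist_fourier psi A B s| <= X%:R.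
  move=> s0; rewrite -(@ler_pXn2r _ 2) ?nnegrE ?mulr_ge0 ?ler0n //.
  rewrite exprMn; apply: (@le_trans _ _ (4 ^+ 2 * (q ^ d * X)%N%:R)).
    by rewrite ler_pM2l ?exprn_gt0 // dist_fourier_bound.
  rewrite -!natrX -natrM ler_nat.
  by rewrite expnS expn1 mulnA leq_mul.
apply: (@le_trans _ _ (4 * `|(q * nu 0%R)%N%:R - X%:R|)).
  by rewrite ler_pM2l // real_ler_norm // rpredB // realn.
rewrite E natrM -sum_neq0_const.
apply: (@le_trans _ _ (\sum_(s | s != 0) 4 * `|dist_fourier psi A B s|)).
  by rewrite -mulr_sumr ler_pM2l // ler_norm_sum.
exact: ler_sum.
Qed.
End SmallCase.

(** * Cauchy-Schwarz over the distance set and the final count *)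

Section DistanceSupport.
Variables (F : finFieldType) (d : nat) (A B : {set 'rV[F]_d}).
Local Notation nu := (dist_count A B).
Local Notation q := (fsize F).

Lemma dist_count_eq0 t : t \notin dist_set A B -> nu t = 0%N.
Proof.
move=> tD; rewrite /dist_count big1 // => a aA; rewrite big1 // => b bB.
by apply/eqP; rewrite eqb0; apply: contraNneq tD => <-; apply/imset2P; exists a b.
Qed.

Lemma dist_count_CS (P : pred F) :
  ((\sum_(t | P t) nu t) ^ 2 <= #|dist_set A B| * \sum_(t | P t) nu t ^ 2)%N.
Proof.
set D := dist_set A B.
have red (f : nat -> nat) : f 0%N = 0%N ->
    (\sum_(t | P t) f (nu t) = \sum_(t in [pred t in D | P t]) f (nu t))%N.
  move=> f0; rewrite (bigID (fun t => t \in D)) /= [X in (_ + X)%N]big1 ?addn0 => [|t].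
    by apply: eq_bigl => t; rewrite !inE andbC.
  by case/andP=> _ /dist_count_eq0 ->.
rewrite (red id) // (red (fun n => n ^ 2)%N) // -(ler_nat algC).
apply: (@le_trans _ _ (#|[pred t in D | P t]|%:R *
    \sum_(t in [pred t in D | P t]) `|(nu t)%:R : algC| ^+ 2)).
  by rewrite natrX natr_sum -[leLHS]ger0_norm ?exprn_ge0 ?sumr_ge0 // normrX sum_sqr_le.
rewrite natrM natr_sum; apply: ler_pM => //.
- by apply: sumr_ge0 => t _; rewrite exprn_ge0.
- by rewrite ler_nat subset_leq_card //; apply/subsetP => t; rewrite !inE => /andP[].
by apply: ler_sum => t _; rewrite normr_nat natrX.
Qed.

End DistanceSupport.

Theorem theorem1p20 (F : finFieldType) (hodd : odd #|F|)
    (d : nat) (hd4 : (4 <= d)%N) (hdeven : ~~ odd d)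
    (j : F) (hj : j != 0)
    (A B : {set 'rV[F]_d}) (hA : A \subset sphere d j) :
  (#|A| * #|B| >= 16 * #|F| ^ d)%N ->
  ((#|A| ^ 2 <= #|F| ^ (d - 1))%N \/ (#|F| ^ (d %/ 2) <= #|A|)%N) ->
  (#|F|%:R / 144 : rat) <= (#|dist_set A B|)%:R.
Proof.
change #|F| with (fsize F) in hodd |- *; set q := fsize F.
move=> hX hcase; rewrite ler_pdivrMr // -natrM ler_nat mulnC.
have q1 : (1 < q)%N := fsize_gt1 F.
have [psi hpsi] := addchar_exists F.
have qd0 : (0 < q ^ d)%N by rewrite expn_gt0 ltnW.
have X0 : (0 < #|A| * #|B|)%N by lia.
case: hcase => hAq; last first.
  have hA2 : (q ^ d <= #|A| ^ 2)%N.
    have : ((q ^ (d %/ 2)) ^ 2 <= #|A| ^ 2)%N by rewrite leq_exp2r.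
    by rewrite -expnM divnK // dvdn2.
  have E := large_case_energy hodd hpsi hdeven B hj hA hA2.
  have := dist_count_CS A B predT; rewrite sum_dist_count => CS.
  move: E CS; set S := (\sum_t _)%N; move: S #|dist_set A B| => S D E CS.
  rewrite -/q in E; move: #|A| #|B| (q ^ d)%N hX X0 hA2 E CS => x y Q hX X0 hA2 E CS.
  (* With [X = x * y] and [16 * Q <= X], the three terms add up to at most [3 * X ^ 2 + X ^ 2 / 16];
     this case ends with [q <= 4 * D]. *)
  have {}E : (q * S <= 4 * (x * y) ^ 2)%N.
    by apply: leq_trans E _; nia.
  have : (q * (x * y) ^ 2 <= D * (4 * (x * y) ^ 2))%N.
    by apply: leq_trans (leq_mul (leqnn q) CS) _; rewrite mulnCA leq_mul.
  have : (0 < (x * y) ^ 2)%N by rewrite expn_gt0 X0.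
  by move: ((x * y) ^ 2)%N => Z; nia.
have hA2 : (#|A| ^ 2 * q <= q ^ d)%N.
  have -> : (q ^ d = q ^ (d - 1) * q)%N by rewrite -expnSr subn1 prednK // ltnW // ltnW // ltnW.
  by rewrite leq_mul2r hAq orbT.
have E := small_case_energy hodd hpsi hdeven B hA2.
have Z := zero_count_bound hodd hpsi hX.
have CS := dist_count_CS A B (fun t => t != 0).
have tot := sum_dist_count A B; rewrite (bigD1 0) //= in tot.
have {}tot : (dist_count A B 0%R + nz_count A B = #|A| * #|B|)%N := tot.
have P2 : (#|A| * #|B| <= 2 * nz_count A B)%N.
  (* The distance [0] takes at most [(q + 3) / (4 * q)] of the pairs, which is at most one half once
     [q >= 3]. *)
  have q3 : (2 < q)%N by rewrite /q in q1 *; case: (fsize F) hodd q1 => [|[|[|]]].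
  move: Z tot; rewrite -/q.
  by move: (#|A| * #|B|)%N (dist_count _ _ _) (nz_count _ _) (q) q3 => X n0 P x; nia.
have PX : (nz_count A B <= #|A| * #|B|)%N by rewrite -tot leq_addl.
have ZX : (q * nz_energy A B <= 4 * (#|A| * #|B|) ^ 2)%N.
  (* Let [Y] be the left side and [P] the number of pairs at nonzero distance. If [Y > 4 * X ^ 2],
     then [P * X < Y / 4], and the energy bound gives [9 * Y ^ 2 <= 3 * X ^ 2 * Y], a
     contradiction. *)
  rewrite leqNgt; apply/negP => lt.
  have le : (nz_count A B * (#|A| * #|B|) <= q * nz_energy A B)%N.
    by apply: leq_trans (ltnW lt); nia.
  move: E; rewrite -/q -natrB // normr_nat -natrX ler_nat.
  move: lt le PX X0 hX; rewrite -/q; move: (#|A| * #|B|)%N (nz_count _ _) (q * _)%N (q ^ d)%N.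
  move=> X P Y Q lt le PX X0 hX E.
  have e1 : (3 * Y <= 4 * (Y - P * X))%N by nia.
  have e2 : (16 * (Y - P * X) ^ 2 <= 3 * (X ^ 2 * Y))%N by nia.
  have e3 : (9 * (Y * Y) <= 3 * (X ^ 2 * Y))%N by nia.
  by nia.
(* One factor [4] comes from [X <= 2 * P], the other from the energy bound; the resulting [16] is
   below [144]. *)
have : (q * (#|A| * #|B|) ^ 2 <= (16 * #|dist_set A B|) * (#|A| * #|B|) ^ 2)%N.
  move: CS ZX P2; rewrite -/(nz_count A B) -/(nz_energy A B).
  move: (#|A| * #|B|)%N (nz_count _ _) (nz_energy _ _) #|dist_set A B| => X P Y D CS ZX P2.
  have e1 : (X ^ 2 <= 4 * P ^ 2)%N by nia.
  have e2 : (q * P ^ 2 <= D * (4 * X ^ 2))%N.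
    by apply: leq_trans (leq_mul (leqnn q) CS) _; rewrite mulnCA leq_mul.
  by nia.
rewrite leq_pmul2r ?expn_gt0 ?X0 // => h; apply: leq_trans h _.
by rewrite leq_mul2r orbT.
Qed.
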